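(* Let $k\ge 2$ be an integer and $\alpha=\lceil\frac{k+1}{2}\rceil$. There are constants $A,B>0$ and $c\ge 1$ such that for all sufficiently large $n$, for every initial assignment of opinions in which at least one party has an opinion different from $\bot$, and for every $\sqrt n$-bounded adversary, with probability at least $1-n^{-c}$ Slush with parameters $k,\alpha$ reaches within $A\log n$ rounds a state in which all but at most $B\sqrt n$ parties have the same opinion $b\in\{0,1\}$.
   Context: Slush (synchronous, binary): there are $n$ parties $\{1,\dots,n\}$, each holding an opinion in $\{0,1,\bot\}$ ($\bot$ means no opinion yet). In each round every party with opinion in $\{0,1\}$ independently draws a sample of $k$ parties uniformly at random with repetition from all $n$ parties (samples are independent across parties and rounds) and queries the sampled parties, sending its own current opinion along. A queried party with opinion in $\{0,1\}$ replies with its current opinion (the one held at the start of the round, after the adversary's action). A queried party with opinion $\bot$ first adopts the opinion contained in the first query it receives and then replies with that opinion; parties with opinion $\bot$ do not send queries. If at least $\alpha$ of the $k$ replies received by a party equal $b\in\{0,1\}$, the party adopts opinion $b$; otherwise it keeps its opinion. All these updates are simultaneous at the end of the round, and there is no round limit. An $F$-bounded adversary can, at the beginning of each round, set the opinion of up to $F$ parties (chosen anew each round, depending on the history so far) to values in $\{0,1\}$ of its choice. *)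

(* Defs.v *)
From HB Require Import structures.
From mathcomp Require Import all_boot all_order all_algebra all_fingroup.
From mathcomp Require Import reals exp.

Set Implicit Arguments.
Unset Strict Implicit.
Unset Printing Implicit Defensive.

Import Order.TTheory GRing.Theory Num.Theory.
Local Open Scope ring_scope.

(* [None] is the opinion \bot. *)
Definition opinions (n : nat) := {ffun 'I_n -> option bool}.

(* One k-sample, with repetition, for every party.  The samples of the parties
   with opinion \bot are drawn as well but never used (see [asks]). *)
Definition sampling (n k : nat) := {ffun 'I_n -> k.-tuple 'I_n}.

(* [Some b]: the adversary sets this opinion to [b];
   [None]: the adversary leaves this party alone. *)
Definition corruption (n : nat) := {ffun 'I_n -> option bool}.

Definition corrupt n (a : corruption n) (x : opinions n) : opinions n :=
  [ffun i => if a i is Some b then Some b else x i].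

Section Round.
Variables (n k alpha : nat).

(* Party [i] sends a query to party [j], when the opinions are [y]. *)
Definition asks (y : opinions n) (s : sampling n k) (i j : 'I_n) : bool :=
  (y i != None) && (j \in s i).

(* The queries reach party [j] in the order of their senders
   [d j 0, d j 1, ...].  All queries of one sender carry the same opinion, so
   the order among these is irrelevant. *)
Definition delivery := {ffun 'I_n -> {perm 'I_n}}.

Definition first_asker (d : delivery) (y : opinions n) (s : sampling n k)
    (j : 'I_n) : option 'I_n :=
  ohead [seq i <- codom (d j) | asks y s i j].

Definition reply (d : delivery) (y : opinions n) (s : sampling n k)
    (j : 'I_n) : option bool :=
  if y j is Some b then Some b
  else if first_asker d y s j is Some i then y i else None.

Definition votes (d : delivery) (y : opinions n) (s : sampling n k)
    (i : 'I_n) (b : bool) : nat :=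
  count (fun j => reply d y s j == Some b) (s i).

(* The opinions at the end of a round, from those after the adversary's action.
   For [alpha > k / 2] at most one of the two tests can succeed. *)
Definition slush_round (d : delivery) (y : opinions n) (s : sampling n k) :
    opinions n :=
  [ffun i =>
    if y i is Some b then
      if alpha <= votes d y s i true then Some true
      else if alpha <= votes d y s i false then Some false
      else Some b
    else reply d y s i]%N.

(* Opinions at the start of the round, opinions after the adversary's action,
   and samples of the round. *)
Definition round_log := (opinions n * opinions n * sampling n k)%type.

(* The action depends on the logs of all past rounds, oldest first, and on the
   current opinions. *)
Definition adversary := seq round_log -> opinions n -> corruption n.

Definition adversary_bounded (R : realType) (F : R) (adv : adversary) : Prop :=
  forall h x, #|[set i | adv h x i != None]|%:R <= F.

(* The order in which queries arrive is not part of the protocol: it is an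
   arbitrary function of the history, of the opinions after the adversary's
   action and of the samples of the current round. *)
Definition scheduler :=
  seq round_log -> opinions n -> sampling n k -> delivery.

Definition slush_step (adv : adversary) (sch : scheduler)
    (c : seq round_log * opinions n) (s : sampling n k) :
    seq round_log * opinions n :=
  let: (h, x) := c in
  let y := corrupt (adv h x) x in
  (rcons h (x, y, s), slush_round (sch h y s) y s).

(* The opinions after [size w] rounds, where the samples of round [t] are the
   [t]-th item of [w]. *)
Definition slush (adv : adversary) (sch : scheduler) (x0 : opinions n)
    (w : seq (sampling n k)) : opinions n :=
  (foldl (slush_step adv sch) ([::], x0) w).2.

End Round.

Definition near_consensus (R : realType) n (m : R) (x : opinions n) : bool :=
  [exists b : bool, #|[set i | x i != Some b]|%:R <= m].

(* The outcomes of the first [T] rounds of samples for which Slush is, after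
   some number [t <= T] of rounds, in a state with all but at most [m] parties
   in agreement. *)
Definition reaches_within (R : realType) n k (alpha : nat)
    (adv : adversary n k) (sch : scheduler n k) (x0 : opinions n) (m : R)
    (T : nat) : {set T.-tuple (sampling n k)} :=
  [set w : T.-tuple (sampling n k) |
    [exists t : 'I_T.+1, near_consensus m (slush alpha adv sch x0 (take t w))]].

(* Under the uniform distribution on [T.-tuple (sampling n k)] the individual
   sampled parties are independent and uniform, across samples, parties and
   rounds. *)
Definition unif_prob (R : realType) (Omega : finType) (E : {set Omega}) : R :=
  #|E|%:R / #|Omega|%:R.

(* Main.v *)
Require Import Defs.
From HB Require Import structures.
From mathcomp Require Import all_boot all_order all_algebra all_fingroup.
From mathcomp Require Import reals sequences exp.
From mathcomp Require Import ring lra zify.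

(* One potential function V of the opinions shrinks by a constant factor in
   expectation in every round that does not start near consensus; as V lies
   between 1/n and O(n^2), Markov's inequality gives failure probability at
   most O(n^3) rho^T after T rounds.
   While only m < n parties have an opinion, V is of order n (n - m) / m: if N
   parties are informed in the round, then N <= k m, E N >= (n - m) m / (2 n),
   and (n - m - N) / (m + N) <= (n - m) / m - n N / ((k + 1) m^2).
   Once all parties have opinions, let d in [-1, 1] be the normalized difference
   of the two camps and kappa = 32 / sqrt n; then
   V = kappa (1 - |d|) / max(|d|, kappa).
   For |d| >= kappa the mean of the next d is at least d (3 - d^2) / 2 up to the
   adversary's 2 / sqrt n, its variance is at most 2 (1 - mean) / n, and a
   second-order expansion of V bounds E V.  For |d| < kappa, V is almost 1, but
   with constant probability the sampling noise alone carries |d| beyond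
   2 kappa, where V <= 1/2. *)

Set Implicit Arguments.
Unset Strict Implicit.
Unset Printing Implicit Defensive.

Import Order.TTheory GRing.Theory Num.Theory.
Local Open Scope ring_scope.

(** * Expectation under the uniform distribution on a finite type *)

Section Expectation.
Variable R : realType.

Definition expect (O : finType) (f : O -> R) : R := (\sum_w f w) / #|O|%:R.

Lemma expectD (O : finType) (f g : O -> R) :
  expect (fun w => f w + g w) = expect f + expect g.
Proof. by rewrite /expect big_split mulrDl. Qed.

Lemma expectZ (O : finType) (a : R) (f : O -> R) :
  expect (fun w => a * f w) = a * expect f.
Proof. by rewrite /expect -mulr_sumr mulrA. Qed.

Lemma expectN (O : finType) (f : O -> R) :
  expect (fun w => - f w) = - expect f.
Proof. by rewrite /expect sumrN mulNr. Qed.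

Lemma expect_sum (O J : finType) (f : J -> O -> R) :
  expect (fun w => \sum_j f j w) = \sum_j expect (f j).
Proof. by rewrite /expect exchange_big mulr_suml. Qed.

Lemma expect_cst (O : finType) (a : R) : (0 < #|O|)%N ->
  expect (fun _ : O => a) = a.
Proof.
by move=> O0; rewrite /expect sumr_const -(mulr_natr a) mulfK // pnatr_eq0 -lt0n.
Qed.

Lemma eq_expect (O : finType) (f g : O -> R) : f =1 g -> expect f = expect g.
Proof. by move=> fg; rewrite /expect (eq_bigr g). Qed.

Lemma expect_eq0 (O : finType) (f : O -> R) :
  (forall w, f w = 0) -> expect f = 0.
Proof. by move=> f0; rewrite /expect big1 ?mul0r. Qed.

Lemma le_expect (O : finType) (f g : O -> R) :
  (forall w, f w <= g w) -> expect f <= expect g.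
Proof. by move=> fg; rewrite ler_wpM2r ?invr_ge0// ler_sum. Qed.

Lemma expect_gt0 (O : finType) (f : O -> R) : (0 < #|O|)%N ->
  (forall w, 0 < f w) -> 0 < expect f.
Proof.
move=> O0 f0; have /card_gt0P[w _] := O0.
rewrite divr_gt0 ?ltr0n// (bigD1 w)//= ltr_wpDr ?sumr_ge0// => i _.
exact: ltW.
Qed.

Lemma expect_indicator (O : finType) (A : {set O}) :
  expect (fun w => (w \in A)%:R) = unif_prob R A.
Proof. by rewrite /expect /unif_prob -natr_sum -big_mkcond sum1_card. Qed.

Lemma expect_pair (O O' : finType) (f : O * O' -> R) :
  expect f = expect (fun a => expect (fun b => f (a, b))).
Proof.
rewrite /expect card_prod natrM invfM mulrA -mulr_suml pair_bigA mulrAC.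
by congr (_ * _ * _); apply: eq_bigr => -[].
Qed.

Lemma expect_tuple0 (O : finType) (f : 0.-tuple O -> R) :
  expect f = f [tuple].
Proof.
by rewrite /expect (bigD1 [tuple])//= big1 ?addr0 ?card_tuple ?expn0 ?divr1//
  => t /eqP[]; exact: tuple0.
Qed.

Lemma expect_tupleS (O : finType) (m : nat) (f : m.+1.-tuple O -> R) :
  expect f = expect (fun x => expect (fun t : m.-tuple O => f [tuple of x :: t])).
Proof.
rewrite -(expect_pair (fun p : O * m.-tuple O => f [tuple of p.1 :: p.2])).
rewrite /expect.
congr (_ / _%:R); last by rewrite card_prod !card_tuple expnS.
rewrite (reindex (fun p : O * m.-tuple O => [tuple of p.1 :: p.2]))//=.
exists (fun t => (thead t, [tuple of behead t])) => [[x t] _|t _] /=.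
  by congr pair; apply: val_inj.
by rewrite -tuple_eta.
Qed.

(** * Independence of the coordinates of a uniform function *)

Section Independence.
Variables (I O : finType).
Hypothesis O_gt0 : (0 < #|O|)%N.

(** Distributivity turns the product of sums into a sum over all functions; every independence
    argument below rests on this. *)
Lemma expect_prod (F : I -> O -> R) :
  expect (fun w : {ffun I -> O} => \prod_i F i (w i)) = \prod_i expect (F i).
Proof.
rewrite /expect -bigA_distr_bigA /= big_split /= card_ffun natrX.
by rewrite prodr_const cardE -cardE exprVn.
Qed.

Lemma expect_coord (i : I) (f : O -> R) :
  expect (fun w : {ffun I -> O} => f (w i)) = expect f.
Proof.
transitivity (expect (fun w : {ffun I -> O} =>
    \prod_j (if j == i then f (w j) else 1))).
  by apply: eq_expect => w; rewrite -big_mkcond big_pred1_eq.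
rewrite (expect_prod (fun j x => if j == i then f x else 1)).
rewrite (bigD1 i)//= eqxx big1 ?mulr1// => j /negbTE ->.
exact: expect_cst.
Qed.

Lemma expect_coord2 (i j : I) (f g : O -> R) : i != j ->
  expect (fun w : {ffun I -> O} => f (w i) * g (w j)) = expect f * expect g.
Proof.
move=> ij; have ji : j != i by rewrite eq_sym.
transitivity (expect (fun w : {ffun I -> O} =>
    \prod_l (if l == i then f (w l) else if l == j then g (w l) else 1))).
  apply: eq_expect => w; rewrite (bigD1 i)//= eqxx (bigD1 j)//=.
  rewrite (negbTE ji) eqxx big1 ?mulr1// => l /andP[].
  by move=> /negbTE -> /negbTE ->.
rewrite (expect_prod (fun l x => if l == i then f x
                                 else if l == j then g x else 1)).
rewrite (bigD1 i)//= eqxx (bigD1 j)//= (negbTE ji) eqxx.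
rewrite big1 ?mulr1// => l /andP[/negbTE -> /negbTE ->].
exact: expect_cst.
Qed.

(** The summands are independent and centred, so the cross terms have mean zero and only the
    diagonal survives. *)
Lemma expect_sqr_sum (Y : I -> O -> R) :
  (forall i, expect (Y i) = 0) ->
  expect (fun w : {ffun I -> O} => (\sum_i Y i (w i)) ^+ 2) =
  \sum_i expect (fun x => Y i x ^+ 2).
Proof.
move=> Y0.
transitivity (expect (fun w : {ffun I -> O} =>
    \sum_i \sum_j Y i (w i) * Y j (w j))).
  apply: eq_expect => w; rewrite expr2 mulr_suml; apply: eq_bigr => i _.
  by rewrite mulr_sumr.
rewrite expect_sum; apply: eq_bigr => i _.
rewrite (expect_sum (fun j (w : {ffun I -> O}) => Y i (w i) * Y j (w j))).
rewrite (bigD1 i)//= big1 ?addr0 => [|j ji].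
  exact: (expect_coord i (fun x => Y i x ^+ 2)).
by rewrite expect_coord2 1?eq_sym// Y0 mul0r.
Qed.

End Independence.

(* Paley-Zygmund inequality; the pointwise bound is
   [1_A >= 2 c Z 1_A - (c Z)^2] with [c = E Z / (2 E Z^2)]. *)
Lemma paley_zygmund (O : finType) (Z : O -> R) :
  (forall w, 0 < Z w) -> (0 < #|O|)%N ->
  expect Z ^+ 2 / (4 * expect (fun w => Z w ^+ 2)) <=
  expect (fun w => (expect Z / 2 <= Z w)%R%:R).
Proof.
move=> Z0 O0; set e := expect Z; set v := expect (fun w => Z w ^+ 2).
have e0 : 0 < e by exact: expect_gt0.
have v0 : 0 < v by apply: expect_gt0 => // w; rewrite exprn_gt0.
pose c := e / (2 * v).
have c0 : 0 < c by apply: divr_gt0 => //; exact: mulr_gt0.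
have -> : e ^+ 2 / (4 * v) =
    expect (fun w => c * 2 * Z w + (- (c * e) + - c ^+ 2 * Z w ^+ 2)).
  rewrite !expectD !expectZ (expect_cst (- (c * e)) O0) -/e -/v /c.
  by field; rewrite gt_eqF.
apply: le_expect => w; rewrite -/e; case: (lerP (e / 2) (Z w)) => h /=.
  have := sqr_ge0 (1 - c * Z w); have := mulr_gt0 c0 e0; nra.
have := sqr_ge0 (c * Z w); nra.
Qed.

End Expectation.

(** * Binomial tails and the drift of majority voting *)

Section Binomial.
Variable R : realType.

(** The probability that a binomial variable with [k] trials of success probability [p] is at least
    [j], computed by conditioning on the first trial. *)
Fixpoint binom_tail (p : R) (k j : nat) : R :=
  match k, j with
  | _, 0 => 1
  | 0, _.+1 => 0
  | k'.+1, j'.+1 => p * binom_tail p k' j' + (1 - p) * binom_tail p k' j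
  end.

Lemma binom_tail0 p k : binom_tail p k 0 = 1.
Proof. by case: k. Qed.

Lemma binom_tailS p k j : binom_tail p k.+1 j.+1 =
  p * binom_tail p k j + (1 - p) * binom_tail p k j.+1.
Proof. by []. Qed.

(** Both sides are the point mass at [j]; the induction is Pascal's rule. For [j > k] the binomial
    coefficient is 0, so the truncated [k - j] does no harm. *)
Lemma binom_tail_diff p k j : binom_tail p k j - binom_tail p k j.+1 =
  'C(k, j)%:R * (p ^+ j * (1 - p) ^+ (k - j)).
Proof.
elim: k j => [|k IHk] [|j].
- by rewrite /= subr0 bin0 !mul1r subn0.
- by rewrite /= subr0 bin0n mul0r.
- rewrite binom_tailS !binom_tail0 !bin0 !mul1r subn0 exprS.
  have := IHk 0; rewrite binom_tail0 bin0 !mul1r subn0 => <-; ring.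
- rewrite !binom_tailS opprD addrACA -!mulrBr !IHk binS natrD subSS.
  have [kj|jk] := ltnP k j.+1; last by rewrite -(subnSK jk) !exprS; ring.
  by rewrite (bin_small kj) exprS; ring.
Qed.

Lemma binom_tail_range p k j : 0 <= p <= 1 ->
  0 <= binom_tail p k j <= 1.
Proof.
move=> /andP[p0 p1]; elim: k j => [|k IHk] [|j] /=; rewrite ?lexx ?ler01//.
have /andP[a b] := IHk j; have /andP[c d] := IHk j.+1.
by apply/andP; split; nra.
Qed.

(** If all [k] trials succeed, the threshold is met. *)
Lemma binom_tail_ge p k j : 0 <= p <= 1 -> (j <= k)%N ->
  p ^+ k <= binom_tail p k j.
Proof.
move=> /andP[p0 p1]; elim: k j => [|k IHk] [|j] //= jk.
  by rewrite exprn_ile1.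
have /andP[_ h] : 0 <= binom_tail p k j.+1 <= 1.
  by apply: binom_tail_range; rewrite p0.
have /andP[h0 _] : 0 <= binom_tail p k j.+1 <= 1.
  by apply: binom_tail_range; rewrite p0.
by rewrite exprS ler_wpDr ?mulr_ge0 ?subr_ge0// ler_wpM2l ?IHk.
Qed.

(** If all [k] trials fail, a positive threshold is missed. *)
Lemma binom_tail_le p k j : 0 <= p <= 1 -> (0 < j)%N ->
  binom_tail p k j <= 1 - (1 - p) ^+ k.
Proof.
move=> p01; have /andP[p0 p1] := p01; case: j => // j _.
elim: k j => [|k IHk] j; first by rewrite /= subrr.
have /andP[_ h] := binom_tail_range k j p01.
have h' := IHk j; rewrite binom_tailS exprS; nra.
Qed.

(* Raising the sample size from [2r + 1] to [2r + 3] changes the probability of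
   a correct majority by ['C(2r + 1, r) * (p * (1 - p)) ^+ r.+1 * (2 * p - 1)]. *)
Lemma odd_majority_mono p r : 2^-1 <= p <= 1 ->
  binom_tail p r.*2.+1 r.+1 <= binom_tail p r.*2.+3 r.+2.
Proof.
move=> /andP[p2 p1].
have d1 := binom_tail_diff p r.*2.+1 r.
have d2 := binom_tail_diff p r.*2.+1 r.+1.
have e1 : (r.*2.+1 - r = r.+1)%N by rewrite -addnn -addnS addKn.
have e2 : (r.*2.+1 - r.+1 = r)%N by rewrite -addnn subSS addKn.
rewrite e1 in d1; rewrite e2 in d2.
have eC : 'C(r.*2.+1, r.+1) = 'C(r.*2.+1, r).
  by rewrite -bin_sub ?e2// -addnn ltnS leq_addl.
rewrite eC in d2.
rewrite -subr_ge0 !(binom_tailS p r.*2.+2) !(binom_tailS p r.*2.+1).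
set a := binom_tail _ _ r in d1 *; set b := binom_tail _ _ r.+1 in d1 d2 *.
set c := binom_tail _ _ r.+2 in d2 *.
(* Two further trials create a majority only from exactly [r] successes, when both succeed, and
   destroy one only from exactly [r.+1], when both fail. *)
have -> : p * (p * a + (1 - p) * b) + (1 - p) * (p * b + (1 - p) * c) - b =
  p ^+ 2 * (a - b) - (1 - p) ^+ 2 * (b - c) by ring.
rewrite d1 d2 (exprS p r) (exprS (1 - p) r).
set x := p ^+ r; set y := (1 - p) ^+ r; set C := _%:R.
have -> : p ^+ 2 * (C * (x * ((1 - p) * y))) -
    (1 - p) ^+ 2 * (C * (p * x * y)) =
  C * (x * y) * (p * ((1 - p) * (2 * p - 1))) by ring.
rewrite !mulr_ge0 ?ler0n ?exprn_ge0 ?subr_ge0//; lra.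
Qed.

(* [p * tail (k.+1 - alpha) + (1 - p) * tail alpha] is the expected fraction of
   parties with opinion [b] after a round when this fraction is [p] before. *)
Lemma majority_drift p k : (2 <= k)%N -> 2^-1 <= p <= 1 ->
  3 * p ^+ 2 - 2 * p ^+ 3 <=
  p * binom_tail p k (k.+1 - uphalf k.+1) +
  (1 - p) * binom_tail p k (uphalf k.+1).
Proof.
move=> k2 hp.
(* The cubic is exactly the majority probability for three samples, the case [r = 1]; larger odd
   sizes do at least as well. *)
have odd_ge r : (0 < r)%N ->
    3 * p ^+ 2 - 2 * p ^+ 3 <= binom_tail p r.*2.+1 r.+1.
  case: r => // r _; elim: r => [|r IHr].
    by rewrite /= le_eqVlt; apply/orP; left; apply/eqP; ring.
  by apply: le_trans IHr _; exact: odd_majority_mono.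
have [r r0 [->|->]] : exists2 r, (0 < r)%N & k = r.*2 \/ k = r.*2.+1.
  exists k./2; first by case: k k2 => [|[]].
  have := odd_double_half k; case: (odd k) => e; [right|left];
    by rewrite -{1}e.
(* For even [k] the own opinion breaks ties and so acts as one more sample; for odd [k] the two
   thresholds coincide and the own opinion drops out. *)
- have -> : (uphalf r.*2.+1 = r.+1)%N by rewrite /= doubleK.
  have -> : (r.*2.+1 - r.+1 = r)%N by rewrite -addnn subSS addKn.
  by rewrite -binom_tailS odd_ge.
- have -> : (uphalf r.*2.+2 = r.+1)%N by rewrite /= uphalf_double.
  have -> : (r.*2.+2 - r.+1 = r.+1)%N by rewrite -addnn subSS -addnS addKn.
  by rewrite -mulrDl subrKC mul1r odd_ge.
Qed.
End Binomial.

(** * Hitting times from multiplicative drift *)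

Section Drift.
Variables (R : realType) (C : Type) (S : finType) (step : C -> S -> C).
Variables (target : pred C) (inv : C -> Prop) (V : C -> R) (rho vmin : R).

Fixpoint avoids (c : C) (w : seq S) : bool :=
  ~~ target c && if w is s :: w' then avoids (step c s) w' else true.

(** Links the recursive form, suited to induction on the word, to the form over all prefixes that
    matches [reaches_within]. *)
Lemma avoidsE c w : avoids c w =
  [forall t : 'I_(size w).+1, ~~ target (foldl step c (take t w))].
Proof.
elim: w c => [|s w IHw] c /=.
  rewrite andbT; apply/idP/forallP => [h [[|t] lt_t]|/(_ ord0)] //.
rewrite IHw; apply/andP/forallP => [[h /forallP hw] [[|t] lt_t]//|h].
  exact: (hw (Ordinal (lt_t : (t < (size w).+1)%N))).
split; first exact: (h ord0).
by apply/forallP => t; have := h (lift ord0 t).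
Qed.

Hypothesis inv_step : forall c s, inv c -> inv (step c s).
Hypothesis rho_ge0 : 0 <= rho.
Hypothesis V_ge0 : forall c, inv c -> 0 <= V c.
Hypothesis V_ge : forall c, inv c -> ~~ target c -> vmin <= V c.
Hypothesis V_drift : forall c, inv c -> ~~ target c ->
  expect (fun s => V (step c s)) <= rho * V c.

(** Markov's inequality for the process stopped at the target: each round before the target costs a
    factor [rho] in the mean of [V], and [V] is at least [vmin] on surviving paths. The induction
    conditions on the first round. *)
Lemma expect_avoids (T : nat) c : inv c ->
  vmin * expect (fun w : T.-tuple S => (avoids c w)%:R) <= rho ^+ T * V c.
Proof.
elim: T c => [|T IHT] c ic.
  rewrite expect_tuple0 /= andbT mul1r; case: (boolP (target c)) => h /=.
    by rewrite mulr0 V_ge0.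
  by rewrite mulr1 V_ge.
rewrite expect_tupleS -expectZ.
have [h|h] := boolP (target c).
  rewrite expect_eq0 ?mulr_ge0 ?exprn_ge0 ?V_ge0// => s.
  by rewrite expect_eq0 ?mulr0// => w; rewrite /= h.
apply: (@le_trans _ _ (expect (fun s => rho ^+ T * V (step c s)))).
  by apply: le_expect => s; rewrite /= h; apply: IHT; exact: inv_step.
by rewrite expectZ exprSr -mulrA ler_wpM2l ?exprn_ge0 ?V_drift.
Qed.

End Drift.

(** * The potential of an imbalance and its contraction *)

Section Potential.
Variable R : realType.
Implicit Types kap d mu v s : R.

(** The factor [1 - |d|] measures the distance to consensus; the quotient by the maximum rewards
    leaving the balanced state. Capping at [kap] keeps the value at most 1 where noise outweighs
    drift. *)
Definition imbalance_potential kap d := kap * (1 - `|d|) / Num.max `|d| kap.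
Local Notation phi := imbalance_potential.

Lemma imbalance_potential_le kap d : 0 < kap -> `|d| <= 1 -> phi kap d <= 1 - `|d|.
Proof.
move=> k0 d1; rewrite ler_pdivrMr ?lt_max ?k0 ?orbT// mulrC.
by rewrite ler_wpM2l ?subr_ge0// le_max lexx orbT.
Qed.

Lemma imbalance_potential_ge kap d : 0 < kap <= 1 -> `|d| <= 1 ->
  kap * (1 - `|d|) <= phi kap d.
Proof.
move=> /andP[k0 k1] d1; rewrite ler_pdivlMr ?lt_max ?k0 ?orbT//.
by rewrite ler_piMr ?ge_max ?d1// mulr_ge0 ?subr_ge0// ltW.
Qed.

Lemma imbalance_potential_le_half kap d : 0 < kap ->
  2 * kap <= `|d| <= 1 -> phi kap d <= 2^-1.
Proof.
move=> k0 /andP[dk d1]; rewrite /phi max_l; last lra.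
rewrite ler_pdivrMr; nra.
Qed.

Lemma imbalance_potential_outside kap d : kap <= `|d| ->
  phi kap d = kap * (1 - `|d|) / `|d|.
Proof. by move=> kd; rewrite /phi max_l. Qed.

(* On [mu / 2 <= x] the function [1 / x] is bounded by its second order Taylor
   expansion at [mu] with a doubled quadratic term; on [x < mu / 2] the term
   [4 (x - mu)^2 / mu^2] alone exceeds 1. *)
Lemma imbalance_potential_majorant kap mu x : 0 < kap -> 0 < mu <= 1 -> `|x| <= 1 ->
  phi kap x <= kap * ((1 - mu) / mu - (x - mu) / mu ^+ 2 +
                      2 * (x - mu) ^+ 2 / mu ^+ 3) + 4 * (x - mu) ^+ 2 / mu ^+ 2.
Proof.
move=> k0 /andP[m0 m1] x1; have mn0 : mu != 0 by rewrite gt_eqF.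
have [hx|hx] := lerP (mu / 2) x.
  have x0 : 0 < x by apply: lt_le_trans hx; rewrite divr_gt0.
  apply: ler_wpDr.
    by apply: divr_ge0; [apply: mulr_ge0 => //|]; exact: sqr_ge0.
  apply: (@le_trans _ _ (kap * ((1 - x) / x))).
    rewrite (ger0_norm (ltW x0)) in x1; rewrite mulrA /phi (ger0_norm (ltW x0)).
    apply: ler_wpM2l; first by rewrite mulr_ge0 ?subr_ge0// ltW.
    by rewrite lef_pV2 ?posrE ?lt_max ?x0// le_max lexx.
  rewrite ler_pM2l//.
  rewrite -subr_ge0.
  have -> : (1 - mu) / mu - (x - mu) / mu ^+ 2 +
    2 * (x - mu) ^+ 2 / mu ^+ 3 - (1 - x) / x =
    (x - mu) ^+ 2 * (2 * x - mu) / (x * mu ^+ 3).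
    by field; rewrite mn0 gt_eqF.
  apply: divr_ge0; first by apply: mulr_ge0; [exact: sqr_ge0 | lra].
  by apply: mulr_ge0; rewrite ?exprn_ge0 ?ltW.
have hp : phi kap x <= 1.
  by apply: le_trans (imbalance_potential_le k0 x1) _; rewrite gerBl.
apply: (le_trans hp); rewrite -[X in X <= _]add0r lerD//.
  apply: mulr_ge0; first exact: ltW.
  have mi k : 0 <= (mu ^+ k)^-1 by rewrite invr_ge0 exprn_ge0 ?ltW.
  apply: addr_ge0; first rewrite subr_ge0.
    apply: (@le_trans _ _ 0); last by apply: divr_ge0; lra.
    by apply: mulr_le0_ge0 => //; lra.
  by apply: mulr_ge0 => //; apply: mulr_ge0 => //; exact: sqr_ge0.
rewrite ler_pdivlMr ?exprn_gt0// mul1r.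
nra.
Qed.

(** Here [s] stands for [1 / sqrt n], [d] and [dy] for the imbalance before and after the
    adversary's action, [mu] and [v] for the mean and variance of the next one. Three factors
    multiply: 51/50 for the variance, 2/3 for the drift, 17/15 for the adversary; the product is
    below 9/10. *)
Lemma majorant_contraction s d dy mu v : 0 < s -> 32 * s <= d ->
  32 * s <= 1 - d -> d - 2 * s <= dy <= 1 ->
  dy * (3 - dy ^+ 2) / 2 <= mu <= 1 -> 0 <= v <= 2 * (1 - mu) * s ^+ 2 ->
  32 * s * ((1 - mu) / mu + 2 * v / mu ^+ 3) + 4 * v / mu ^+ 2 <=
  9 / 10 * (32 * s * (1 - d) / d).
Proof.
move=> s0 ds d1s /andP[dyd dy1] /andP[muf mu1] /andP[v0 vle].
have dy0 : 30 * s <= dy by lra.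
have mudy : dy <= mu by apply: le_trans muf; nra.
have mu0 : 0 < mu by lra.
have d0 : 0 < d by lra.
have y0 : 0 < dy by lra.
pose r := (1 - mu) / mu.
have r0 : 0 <= r by apply: divr_ge0; lra.
pose u := s / mu.
have u0 : 0 <= u by apply: divr_ge0; lra.
have u30 : u <= 30^-1 by rewrite ler_pdivrMr//; lra.
have e1 : v / mu ^+ 3 <= 2 * r * u ^+ 2.
  have -> : 2 * r * u ^+ 2 = 2 * (1 - mu) * s ^+ 2 / mu ^+ 3.
    by rewrite /r /u; field; rewrite gt_eqF.
  by apply: ler_wpM2r => //; rewrite invr_ge0 exprn_ge0 ?ltW.
have e2 : v / mu ^+ 2 <= 2 * r * u * s.
  have -> : 2 * r * u * s = 2 * (1 - mu) * s ^+ 2 / mu ^+ 2.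
    by rewrite /r /u; field; rewrite gt_eqF.
  by apply: ler_wpM2r => //; rewrite invr_ge0 exprn_ge0 ?ltW.
have e3 : 32 * s * ((1 - mu) / mu + 2 * v / mu ^+ 3) + 4 * v / mu ^+ 2 <=
    51 / 50 * (32 * s * r).
  rewrite -/r -!(mulrA _ v).
  have a1 : u ^+ 2 <= 900^-1 by nra.
  have a2 : v / mu ^+ 3 <= 450^-1 * r by nra.
  have rs : 0 <= r * s by apply: mulr_ge0; lra.
  have a3 : v / mu ^+ 2 <= 15^-1 * (r * s) by nra.
  nra.
(* With denominators cleared this is [3 * dy <= (2 + dy) * mu]; the cubic bound on [mu] leaves the
   margin [dy^2 (1 - dy) (3 + dy) / 2]. *)
have e4 : r <= 2 / 3 * ((1 - dy) / dy).
  rewrite /r -subr_ge0.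
  have -> : 2 / 3 * ((1 - dy) / dy) - (1 - mu) / mu =
     (2 * mu + dy * mu - 3 * dy) / (3 * dy * mu).
    by field; rewrite !gt_eqF.
  apply: divr_ge0; last by apply: mulr_ge0; lra.
  have h1 : (2 + dy) * (dy * (3 - dy ^+ 2) / 2) <= (2 + dy) * mu.
    by rewrite ler_pM2l; lra.
  have h2 : 0 <= dy ^+ 2 * ((1 - dy) * (3 + dy)).
    by apply: mulr_ge0; [exact: sqr_ge0 | apply: mulr_ge0; lra].
  nra.
(* The adversary lowers [d] by at most [2 * s], which is at most a sixteenth of both [d] and
   [1 - d]. *)
have e5 : (1 - dy) / dy <= 17 / 15 * ((1 - d) / d).
  rewrite ler_pdivrMr// (_ : _ * dy = 17 * (1 - d) * dy / (15 * d)); last first.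
    by field; rewrite gt_eqF.
  rewrite ler_pdivlMr ?mulr_gt0//.
  have q1 : 15 * d <= 16 * dy by lra.
  have q2 : 16 * (1 - dy) <= 17 * (1 - d) by lra.
  have q3 : 0 <= 1 - d by lra.
  nra.
apply: (le_trans e3).
have -> : 32 * s * (1 - d) / d = 32 * s * ((1 - d) / d) by rewrite mulrA.
set q := (1 - d) / d in e5 *.
have q0 : 0 <= q by apply: divr_ge0; lra.
have : r <= 34 / 45 * q by lra.
nra.
Qed.
End Potential.

(** * Anti-concentration of sums of independent signs *)

Section AntiConcentration.
Variable R : realType.
Implicit Types p t u eta lam : R.

(** The moment generating function of a random sign that is +1 with probability [p]. *)
Definition sign_mgf p t : R := p * expR t + (1 - p) * expR (- t).

Lemma expR_ge_sqr u : - 2 <= u -> 1 + u + u ^+ 2 / 4 <= expR u.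
Proof.
move=> u2; have -> : expR u = expR (u / 2) ^+ 2.
  by rewrite -expRM_natl; congr expR; field.
have -> : 1 + u + u ^+ 2 / 4 = (1 + u / 2) ^+ 2 by field.
by rewrite ler_pXn2r ?nnegrE ?expR_ge0 ?expR_ge1Dx//; lra.
Qed.

Lemma expR_le_lin u : 0 <= u <= 2^-1 -> expR u <= 1 + 2 * u.
Proof.
move=> /andP[u0 u2]; have := expR_ge1Dx (- u); rewrite expRN => h.
have e0 := expR_gt0 u.
have : expR u * (1 - u) <= 1 by rewrite -ler_pdivlMl// mulr1.
nra.
Qed.

(** The mean is factored out. The centred values [2 t (1 - p)] and [- 2 t p] have cancelling linear
    terms, and a quarter of their squares averages to [t^2 p (1 - p)]. *)
Lemma sign_mgf_ge p t : 0 <= p <= 1 -> 0 <= t <= 1 ->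
  expR (t * (2 * p - 1)) * (1 + t ^+ 2 * (p * (1 - p))) <= sign_mgf p t.
Proof.
move=> /andP[p0 p1] /andP[t0 t1]; rewrite /sign_mgf.
have -> : expR t = expR (t * (2 * p - 1)) * expR (2 * t * (1 - p)).
  by rewrite -expRD; congr expR; ring.
have -> : expR (- t) = expR (t * (2 * p - 1)) * expR (- (2 * t * p)).
  by rewrite -expRD; congr expR; ring.
rewrite !(mulrCA _ (expR (t * _))) -mulrDr ler_pM2l ?expR_gt0//.
have h1 : 1 + 2 * t * (1 - p) + (2 * t * (1 - p)) ^+ 2 / 4 <=
    expR (2 * t * (1 - p)) by apply: expR_ge_sqr; nra.
have h2 : 1 + - (2 * t * p) + (- (2 * t * p)) ^+ 2 / 4 <=
    expR (- (2 * t * p)) by apply: expR_ge_sqr; nra.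
have := ler_wpM2l p0 h1.
have q0 : 0 <= 1 - p by rewrite subr_ge0.
have := ler_wpM2l q0 h2.
move=> a b; apply: le_trans (lerD b a); rewrite le_eqVlt; apply/orP; left.
by apply/eqP; field.
Qed.

(** The excess of the left side over [sign_mgf p t ^+ 2] is the variance of the exponential of the
    sign, at most [(3 t)^2 / 4], while that square is at least 1/4. *)
Lemma sign_mgf_double p t : 0 <= p <= 1 -> 0 <= t <= 2^-1 ->
  sign_mgf p (2 * t) <= sign_mgf p t ^+ 2 * (1 + 9 * t ^+ 2).
Proof.
move=> /andP[p0 p1] /andP[t0 t2]; rewrite /sign_mgf -mulrN.
rewrite !expRM_natl.
have h1 := expR_le_lin (u := t); rewrite t0 t2 in h1; have {}h1 := h1 isT.
have h2 := expR_ge1Dx (- t).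
have h3 := expR_ge1Dx t.
have : expR t * expR (- t) = 1 by rewrite expRN divff ?expR_eq0.
set x := expR t in h1 h3 *; set y := expR (- t) in h2 * => xy.
have y1 : y <= 1 by rewrite expR_le1; lra.
have -> : p * x ^+ 2 + (1 - p) * y ^+ 2 =
   (p * x + (1 - p) * y) ^+ 2 + p * (1 - p) * (x - y) ^+ 2 by ring.
set M := p * x + _.
have M2 : 2^-1 <= M.
  have : p * (1 - t) <= p * x by apply: ler_wpM2l => //; lra.
  have : (1 - p) * (1 - t) <= (1 - p) * y by apply: ler_wpM2l => //; lra.
  rewrite /M; nra.
have a1 : (x - y) ^+ 2 <= (3 * t) ^+ 2.
  by rewrite ler_pXn2r ?nnegrE//; lra.
have a2 : p * (1 - p) <= 4^-1 by have := sqr_ge0 (p - 2^-1); nra.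
have a3 : 4^-1 <= M ^+ 2 by nra.
have a4 : 0 <= p * (1 - p) by apply: mulr_ge0; lra.
rewrite [M ^+ 2 * _]mulrDr mulr1 lerD2l.
apply: (@le_trans _ _ (4^-1 * (3 * t) ^+ 2)).
  by apply: ler_pM => //; exact: sqr_ge0.
rewrite (_ : 4^-1 * _ = 4^-1 * (9 * t ^+ 2)); last by ring.
by apply: ler_wpM2r => //; apply: mulr_ge0 => //; exact: sqr_ge0.
Qed.

Lemma expect_sign_mgf (O : finType) (X : O -> bool) t : (0 < #|O|)%N ->
  expect (fun w => expR (t * (2 * (X w)%:R - 1))) =
  sign_mgf (expect (fun w => (X w)%:R)) t.
Proof.
move=> O0; rewrite /sign_mgf.
transitivity (expect (fun w => (expR t - expR (- t)) * (X w)%:R + expR (- t))).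
  apply: eq_expect => w; case: (X w) => /=.
    by rewrite (_ : t * _ = t); ring.
  by rewrite (_ : t * _ = - t); ring.
by rewrite expectD expectZ (expect_cst _ O0); ring.
Qed.

Lemma prod_le_pow (I : finType) (F G : I -> R) (c : R) :
  (forall i, 0 <= F i) -> (forall i, F i <= G i * c) ->
  \prod_i F i <= (\prod_i G i) * c ^+ #|I|.
Proof.
move=> F0 FG; rewrite -prodr_const -big_split /=.
by apply: ler_prod => i _; rewrite F0 FG.
Qed.

(* Paley-Zygmund for [Z = exp (t * S)], [t = lam / sqrt n], with S the sum: the
   event [Z >= E Z / 2] forces [S >= ell * sqrt n], as [E Z >= exp (lam^2 eta / 4)],
   and it has constant probability, as [E Z^2 <= exp (9 lam^2) (E Z)^2]. *)
Lemma anticoncentration (I O : finType) (X : I -> O -> bool) (eta ell lam : R) :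
  (0 < #|O|)%N -> 0 < eta <= 2^-1 -> 0 <= ell ->
  (forall i, eta <= expect (fun w => (X i w)%:R : R) <= 1 - eta) ->
  0 <= \sum_i (2 * expect (fun w => (X i w)%:R : R) - 1) ->
  lam = 4 * (ell + 1) / eta -> (2 * lam) ^+ 2 <= #|I|%:R ->
  expR (- (9 * lam ^+ 2)) / 4 <=
  expect (fun w : {ffun I -> O} =>
    (ell * Num.sqrt #|I|%:R <= \sum_i (2 * (X i (w i))%:R - 1))%R%:R).
Proof.
pose p i : R := expect (fun w => (X i w)%:R : R); pose n := #|I|.
move=> O_gt0 eta_range ell_ge0 p_range mean_ge0 lamE n_large.
have {}p_range i : eta <= p i <= 1 - eta by exact: p_range.
have /andP[eta0 eta2] := eta_range.
have lam1 : 1 <= lam by rewrite lamE ler_pdivlMr//; lra.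
have n0 : 0 < n%:R :> R by apply: lt_le_trans n_large; rewrite exprn_gt0//; lra.
pose r : R := Num.sqrt n%:R.
have r0 : 0 < r by rewrite sqrtr_gt0.
have r2 : r ^+ 2 = n%:R by rewrite sqr_sqrtr// ltW.
have rlam : 2 * lam <= r.
  by rewrite -(@ler_pXn2r _ 2) ?nnegrE ?r2//; lra.
pose t : R := lam / r.
have t0 : 0 < t by rewrite divr_gt0//; lra.
have t2 : t <= 2^-1 by rewrite ler_pdivrMr//; lra.
have nt : n%:R * t ^+ 2 = lam ^+ 2.
  by rewrite -r2 /t; field; rewrite gt_eqF.
pose Z (w : {ffun I -> O}) := expR (t * \sum_i (2 * (X i (w i))%:R - 1)).
have EZ u : expect (fun w : {ffun I -> O} =>
    expR (u * \sum_i (2 * (X i (w i))%:R - 1))) = \prod_i sign_mgf (p i) u.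
  transitivity (expect (fun w : {ffun I -> O} =>
      \prod_i expR (u * (2 * (X i (w i))%:R - 1)))).
    by apply: eq_expect => w; rewrite mulr_sumr expR_sum.
  rewrite (expect_prod (fun i x => expR (u * (2 * (X i x)%:R - 1)))).
  by apply: eq_bigr => i _; rewrite expect_sign_mgf.
have p01 i : 0 <= p i <= 1 by have /andP[] := p_range i; lra.
(* The mean factors multiply to at least 1 because the signs have nonnegative total mean; each
   variance factor is at least [expR (t ^+ 2 * eta / 4)] by [expR_le_lin]. *)
have Zlb : expR (lam ^+ 2 * eta / 4) <= expect Z.
  rewrite /Z EZ.
  apply: (@le_trans _ _ (\prod_i (expR (t * (2 * p i - 1)) *
     expR (t ^+ 2 * eta / 4)))); last first.
    apply: ler_prod => i _; rewrite mulr_ge0 ?expR_ge0//=.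
    apply: le_trans (sign_mgf_ge (p01 i) _); last by apply/andP; split; lra.
    rewrite ler_pM2l ?expR_gt0//.
    have q : eta / 2 <= p i * (1 - p i) by have /andP[] := p_range i; nra.
    have tt : 0 <= t ^+ 2 <= 1 by apply/andP; split; nra.
    have := expR_le_lin (u := t ^+ 2 * eta / 4).
    have -> : 0 <= t ^+ 2 * eta / 4 <= 2^-1 by apply/andP; split; nra.
    move=> /(_ isT); nra.
  rewrite big_split /= -expR_sum -mulr_sumr prodr_const -expRM_natl -/n.
  rewrite (_ : n%:R * _ = lam ^+ 2 * eta / 4); last first.
    by rewrite -nt; field.
  rewrite ler_peMl ?expR_ge0//; apply: le_trans (expR_ge1Dx _).
  by rewrite lerDl mulr_ge0// ltW.
have EZ2 : expect (fun w => Z w ^+ 2) <= expect Z ^+ 2 * expR (9 * lam ^+ 2).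
  rewrite (_ : expect _ = \prod_i sign_mgf (p i) (2 * t)); last first.
    rewrite -EZ; apply: eq_expect => w.
    by rewrite /Z -expRM_natl mulrA.
  rewrite /Z EZ -prodrXl.
  apply: (@le_trans _ _ (\prod_i (sign_mgf (p i) t ^+ 2) *
      (1 + 9 * t ^+ 2) ^+ #|I|)).
    apply: prod_le_pow => i.
      have /andP[h1 h2] := p01 i.
      by rewrite addr_ge0// mulr_ge0 ?expR_ge0 ?subr_ge0.
    by apply: sign_mgf_double => //; apply/andP; split; lra.
  apply: ler_wpM2l; first by apply: prodr_ge0 => i _; exact: sqr_ge0.
  rewrite -nt (mulrCA 9 n%:R) (expRM_natl n).
  apply: lerXn2r; rewrite ?nnegrE ?expR_ge0 ?expR_ge1Dx//.
  by apply: addr_ge0 => //; apply: mulr_ge0 => //; exact: sqr_ge0.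
have Zpos w : 0 < Z w by exact: expR_gt0.
have Om : (0 < #|{ffun I -> O}|)%N by rewrite card_ffun expn_gt0 O_gt0.
have pz := paley_zygmund Zpos Om.
have EZpos : 0 < expect Z by apply: lt_le_trans Zlb; exact: expR_gt0.
apply: (@le_trans _ _ (expect Z ^+ 2 / (4 * expect (fun w => Z w ^+ 2)))).
  have E2 : 0 < expect (fun w => Z w ^+ 2).
    by apply: expect_gt0 => // w; rewrite exprn_gt0.
  rewrite ler_pdivlMr; last exact: mulr_gt0.
  rewrite expRN.
  rewrite (_ : _ / 4 * _ = expect (fun w => Z w ^+ 2) / expR (9 * lam ^+ 2)).
    by rewrite ler_pdivrMr ?expR_gt0.
  by field; rewrite expR_eq0.
apply: (le_trans pz); apply: le_expect => w.
case: (lerP (expect Z / 2) (Z w)) => // hZ.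
rewrite -/n -/r; suff -> : ell * r <= \sum_i (2 * (X i (w i))%:R - 1) by [].
rewrite leNgt; apply/negP => hlt.
have : Z w < expR (lam * ell).
  rewrite ltr_expR /t mulrAC -mulrA ltr_pM2l; last lra.
  by rewrite ltr_pdivrMr.
(* The choice of [lam] makes the exponent [lam * ell + lam], and [expR lam >= 2] pays for the half
   in the Paley-Zygmund event. *)
have : expR (lam * ell) * 2 <= expR (lam ^+ 2 * eta / 4).
  have -> : lam ^+ 2 * eta / 4 = lam * ell + lam.
    by rewrite lamE; field; rewrite gt_eqF.
  rewrite expRD ler_pM2l ?expR_gt0//; have := expR_ge1Dx lam; lra.
lra.
Qed.

End AntiConcentration.

(** * Mean and variance of a round in which every party has an opinion *)

Section DecidedRound.
Variables (R : realType) (n k : nat).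
Implicit Types (x y : opinions n) (b : bool) (s : sampling n k).
Local Notation alpha := (uphalf k.+1).

Definition decided x := [forall i, x i != None].

Definition share b x : R := #|[pred i | x i == Some b]|%:R / n%:R.

(** The normalized difference of the camps only if [x] is decided; otherwise a party without opinion
    counts against [b]. *)
Definition imbalance b x : R := 2 * share b x - 1.

(** No delivery order enters: once every party has an opinion all replies are fixed in advance, so a
    party's update depends on its own sample only and the updates are independent. *)
Definition updated y (o : option bool) (t : k.-tuple 'I_n) : option bool :=
  if (alpha <= count (fun j => y j == Some true) t)%N then Some true
  else if (alpha <= count (fun j => y j == Some false) t)%N then Some false
  else o.

Lemma slush_round_decided d y s i : decided y ->
  slush_round alpha d y s i = updated y (y i) (s i).
Proof.
move=> /forallP yd; have rE j : reply d y s j = y j.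
  by rewrite /reply; case: (y j) (yd j).
have cE b : votes d y s i b = count (fun j => y j == Some b) (s i).
  by apply: eq_count => j /=; rewrite rE.
rewrite ffunE !cE /updated rE.
by case: (y i) (yd i).
Qed.

Lemma decided_round d y s : decided y -> decided (slush_round alpha d y s).
Proof.
move=> yd; apply/forallP => i; rewrite slush_round_decided// /updated.
by do 2!case: ifP => // _; exact: (forallP yd).
Qed.

(** The two counts sum to [k], so a holder of [b] keeps it exactly if the other opinion stays below
    [alpha]. As [k < 2 alpha], the order of the tests is irrelevant. *)
Lemma updatedE y (o b : bool) (t : k.-tuple 'I_n) : decided y ->
  (updated y (Some o) t == Some b) =
  ((if o == b then k.+1 - alpha else alpha) <=
     count (fun j => y j == Some b) t)%N.
Proof.
move=> /forallP yd.
have cE : (count (fun j => y j == Some true) t +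
    count (fun j => y j == Some false) t)%N = k.
  rewrite -[RHS](size_tuple t) -[RHS](count_predC (fun j => y j == Some true)).
  congr addn; apply: eq_count => j /=.
  by case: (y j) (yd j) => // -[].
have kE : (k.+1 <= alpha + alpha <= k.+2)%N.
  by have := odd_double_half k; rewrite /= -addnn; case: (odd k) => /=; lia.
rewrite /updated; move: cE kE.
move: (uphalf k.+1) => a.
have neq : ((Some true == Some false) = false) *
           ((Some false == Some true) = false) by [].
case: b; move: (count (fun j => y j == Some true) t) => u;
  move: (count (fun j => y j == Some false) t) => v cE kE;
  by case: o => /=; case: (leqP a u); case: (leqP a v) => /= *;
    rewrite ?eqxx ?neq; lia.
Qed.

(** Drawing the sampled parties one by one reproduces the recursion of [binom_tail]. *)
Lemma expect_count (P : pred 'I_n) (j : nat) : (0 < n)%N ->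
  expect (fun t : k.-tuple 'I_n => (j <= count P t)%N%:R) =
  binom_tail (#|P|%:R / n%:R : R) k j.
Proof.
move=> n0; have n0' : (n%:R : R) != 0 by rewrite pnatr_eq0 -lt0n.
have card0 m : (0 < #|{: m.-tuple 'I_n}|)%N.
  by rewrite card_tuple card_ord expn_gt0 n0.
elim: k j => [|m IHm] [|j]; rewrite ?binom_tail0 ?(expect_cst 1)//.
  by rewrite expect_eq0// => t; rewrite tuple0.
rewrite expect_tupleS binom_tailS -!IHm.
pose E j' : R := expect (fun t : m.-tuple 'I_n => (j' <= count P t)%N%:R).
rewrite -/(E j) -/(E j.+1).
transitivity (expect (fun a => (E j - E j.+1) * (P a)%:R + E j.+1)).
  apply: eq_expect => a; case: (boolP (P a)) => h.
    rewrite mulr1 subrK; apply: eq_expect => t /=.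
    by rewrite h add1n.
  rewrite mulr0 add0r; apply: eq_expect => t /=.
  by rewrite (negbTE h) add0n.
rewrite expectD expectZ expect_cst ?card_ord//.
rewrite (_ : expect _ = #|P|%:R / n%:R); first by ring.
by rewrite /expect card_ord -natr_sum -big_mkcond sum1_card.
Qed.

Hypothesis n_gt0 : (0 < n)%N.
Let n0 : 0 < n%:R :> R. Proof. by rewrite ltr0n. Qed.
Let nN0 : n%:R != 0 :> R. Proof. by rewrite gt_eqF. Qed.
Let card_samples : (0 < #|{: k.-tuple 'I_n}|)%N.
Proof. by rewrite card_tuple card_ord expn_gt0 n_gt0. Qed.

Lemma share_sum b x : share b x = (\sum_i (x i == Some b)%:R) / n%:R.
Proof. by rewrite /share -natr_sum -big_mkcond sum1_card. Qed.

Lemma share_range b x : 0 <= share b x <= 1.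
Proof.
rewrite divr_ge0//= ler_pdivrMr// mul1r ler_nat.
by rewrite (leq_trans (max_card _)) ?card_ord.
Qed.

Lemma imbalance_sum b x :
  imbalance b x = (\sum_i (2 * (x i == Some b)%:R - 1)) / n%:R.
Proof.
rewrite /imbalance share_sum sumrB sumr_const card_ord -mulr_sumr mulrBl.
by rewrite divff// mulrA.
Qed.

Lemma imbalance_norm b x : `|imbalance b x| <= 1.
Proof.
by have /andP[] := share_range b x; rewrite ler_norml /imbalance; lra.
Qed.

Lemma shareN b x : decided x -> share (~~ b) x = 1 - share b x.
Proof.
move=> /forallP xd; rewrite !share_sum.
rewrite -[X in X - _ / _](divff nN0) -mulrBl; congr (_ / _).
apply/eqP; rewrite eq_sym subr_eq -big_split /=; apply/eqP.
rewrite (eq_bigr (fun=> 1)) ?sumr_const ?card_ord// => i _.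
by case: (x i) (xd i) => [[]|]//; case: b => _; rewrite ?addr0 ?add0r.
Qed.

Lemma imbalanceN b x : decided x -> imbalance (~~ b) x = - imbalance b x.
Proof. by move=> xd; rewrite /imbalance shareN//; ring. Qed.

Lemma imbalance_corrupt b (a : corruption n) x :
  `|imbalance b (corrupt a x) - imbalance b x| <=
  2 * #|[set i | a i != None]|%:R / n%:R.
Proof.
have -> : imbalance b (corrupt a x) - imbalance b x = 2 *
    (\sum_i ((corrupt a x i == Some b)%:R - (x i == Some b)%:R)) / n%:R.
  by rewrite sumrB /imbalance !share_sum; field.
rewrite !normrM normfV !normr_nat.
apply: ler_wpM2r; first by rewrite invr_ge0 ltW.
apply: ler_wpM2l => //; apply: (le_trans (ler_norm_sum _ _ _)).
rewrite -sum1_card natr_sum [X in _ <= X]big_mkcond /=.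
apply: ler_sum => i _; rewrite inE ffunE; case: (a i) => [c|] /=.
  by do 2!case: (_ == _); rewrite ?subrr ?subr0 ?sub0r ?normrN ?normr0 ?normr1.
by rewrite subrr normr0.
Qed.

Lemma not_near_imbalance m b x : ~~ near_consensus m x ->
  imbalance b x < 1 - 2 * m / n%:R.
Proof.
rewrite negb_exists => /forallP /(_ b); rewrite -ltNge => h.
have e : #|[pred i | x i == Some b]|%:R + #|[set i | x i != Some b]|%:R = n%:R :> R.
  rewrite -natrD -[X in _ = X%:R](card_ord n) -(cardC [pred i | x i == Some b]).
  by congr (_ + _)%:R; apply: eq_card => i; rewrite !inE.
rewrite /imbalance /share -subr_gt0.
have -> : 1 - 2 * m / n%:R - (2 * (#|[pred i | x i == Some b]|%:R / n%:R) - 1) =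
   2 * (#|[set i | x i != Some b]|%:R - m) / n%:R.
  by rewrite -e; field; rewrite e.
by rewrite divr_gt0// mulr_gt0// subr_gt0.
Qed.

Definition prob_agree b y (i : 'I_n) : R :=
  expect (fun t : k.-tuple 'I_n => (updated y (y i) t == Some b)%:R).

Lemma prob_agreeE b y i : decided y ->
  prob_agree b y i =
  binom_tail (share b y) k (if y i == Some b then k.+1 - alpha else alpha)%N.
Proof.
move=> yd; rewrite /prob_agree -expect_count//; apply: eq_expect => t.
have : y i != None by exact: (forallP yd).
by case: (y i) => // o _; rewrite updatedE.
Qed.

Lemma expect_imbalance b y d : decided y ->
  expect (fun s => imbalance b (slush_round alpha (d s) y s)) =
  (\sum_i (2 * prob_agree b y i - 1)) / n%:R.
Proof.
move=> yd.
transitivity (expect (fun s : sampling n k =>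
  (n%:R^-1 : R) * \sum_i (2 * (updated y (y i) (s i) == Some b)%:R - 1))).
  apply: eq_expect => s; rewrite imbalance_sum mulrC; congr (_ * _).
  by apply: eq_bigr => i _; rewrite slush_round_decided.
rewrite expectZ mulrC expect_sum; congr (_ * _); apply: eq_bigr => i _.
rewrite (expect_coord _ i (fun t => 2 * (updated y (y i) t == Some b)%:R - 1 : R))//.
by rewrite expectD expectZ (expect_cst (- 1)).
Qed.

(** Averaging over both camps leads to [majority_drift] at [p = (1 + d) / 2], where
    [2 (3 p^2 - 2 p^3) - 1 = d (3 - d^2) / 2]. *)
Lemma expect_imbalance_ge b y d : (2 <= k)%N -> decided y ->
  0 <= imbalance b y ->
  imbalance b y * (3 - imbalance b y ^+ 2) / 2 <=
  expect (fun s => imbalance b (slush_round alpha (d s) y s)).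
Proof.
move=> k2 yd i0; rewrite expect_imbalance//.
set p := share b y.
have p01 := share_range b y; rewrite -/p in p01.
have p2 : 2^-1 <= p <= 1.
  by move: i0 p01; rewrite /imbalance -/p => i0 /andP[_ ->]; rewrite andbT; lra.
have -> : (\sum_i (2 * prob_agree b y i - 1)) / n%:R =
    2 * (p * binom_tail p k (k.+1 - alpha) + (1 - p) * binom_tail p k alpha) - 1.
  rewrite sumrB sumr_const card_ord mulrBl divff// -mulr_sumr -mulrA.
  congr (2 * _ - 1).
  transitivity ((\sum_i ((binom_tail p k (k.+1 - alpha) - binom_tail p k alpha) *
      (y i == Some b)%:R + binom_tail p k alpha)) / n%:R).
    congr (_ / _); apply: eq_bigr => i _; rewrite prob_agreeE// -/p.
    by case: (y i == Some b) => /=; ring.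
  rewrite big_split /= sumr_const card_ord -mulr_sumr mulrDl -mulrA.
  rewrite -share_sum -/p -(mulr_natr (binom_tail p k alpha)) mulfK//; ring.
have := majority_drift k2 p2; rewrite /imbalance -/p; lra.
Qed.

(** A sign of mean [m] has variance [1 - m^2 <= 2 (1 - m)]. The factor [1 - mu] keeps the noise
    proportional to the potential near consensus. *)
Lemma variance_imbalance b y d mu : decided y ->
  mu = expect (fun s => imbalance b (slush_round alpha (d s) y s)) ->
  expect (fun s => (imbalance b (slush_round alpha (d s) y s) - mu) ^+ 2) <=
  2 * (1 - mu) / n%:R.
Proof.
move=> yd ->; rewrite expect_imbalance//.
pose X i t : R := 2 * (updated y (y i) t == Some b)%:R - 1.
pose m i : R := expect (X i).
have mE i : 2 * prob_agree b y i - 1 = m i.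
  by rewrite /m /X /prob_agree expectD expectZ (expect_cst (- 1)).
rewrite (eq_bigr m) => [|i _]; last exact: mE.
have Y0 i : expect (fun t => X i t - m i) = 0.
  by rewrite expectD (expect_cst (- m i))// subrr.
have Y2 i : expect (fun t => (X i t - m i) ^+ 2) <= 2 * (1 - m i).
  rewrite (_ : expect _ = expect (fun t => - (2 * m i) * X i t + (1 + m i ^+ 2))).
    rewrite expectD expectZ (expect_cst (1 + _))// -/(m i).
    have := sqr_ge0 (1 - m i); nra.
  apply: eq_expect => t; rewrite /X; case: (_ == _) => /=; ring.
rewrite (_ : expect _ = n%:R ^- 2 * \sum_i expect (fun t => (X i t - m i) ^+ 2)).
  have -> : 2 * (1 - (\sum_i m i) / n%:R) / n%:R =
      n%:R ^- 2 * \sum_i 2 * (1 - m i).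
    by rewrite -mulr_sumr sumrB sumr_const card_ord; field.
  by apply: ler_wpM2l; rewrite ?invr_ge0 ?exprn_ge0 ?ler0n// ler_sum.
rewrite -(expect_sqr_sum card_samples Y0) -expectZ; apply: eq_expect => s.
have -> : imbalance b (slush_round alpha (d s) y s) =
    (\sum_i X i (s i)) / n%:R.
  rewrite imbalance_sum; congr (_ / _).
  by apply: eq_bigr => i _; rewrite slush_round_decided.
by rewrite -mulrBl -sumrB exprMn exprVn mulrC.
Qed.

End DecidedRound.

(** * Contraction of the potential once every party has an opinion *)

Section DecidedDrift.
Variables (R : realType) (n k : nat).
Implicit Types (x y : opinions n) (b : bool) (a : corruption n).
Local Notation alpha := (uphalf k.+1).
Local Notation rt := (Num.sqrt n%:R : R).
Local Notation imb := (@imbalance R n).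

Lemma majority_threshold : (2 <= k)%N ->
  (0 < alpha <= k)%N && (0 < k.+1 - alpha <= k)%N.
Proof.
by have := odd_double_half k; rewrite /= -addnn; case: (odd k) => /=; lia.
Qed.

Lemma decided_corrupt a x : decided x -> decided (corrupt a x).
Proof.
by move=> /forallP xd; apply/forallP => i; rewrite ffunE; case: (a i) => //.
Qed.

Lemma imbalance_normE b x : (0 < n)%N -> decided x ->
  `|imb b x| = `|imb true x|.
Proof.
by move=> n0 xd; case: b => //; rewrite -[false]/(~~ true) imbalanceN ?normrN.
Qed.

Lemma majority_opinion x : (0 < n)%N -> decided x ->
  exists b, imb b x = `|imb true x|.
Proof.
move=> n0 xd; have [h|h] := lerP 0 (imb true x).
  by exists true; rewrite ger0_norm.
by exists false; rewrite -[false]/(~~ true) imbalanceN// ltr0_norm.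
Qed.

Lemma decided_drift_outside a x (d : sampling n k -> delivery n) :
  (2 <= k)%N -> (0 < n)%N -> decided x ->
  ~~ near_consensus (16 * rt) x -> #|[set i | a i != None]|%:R <= rt ->
  32 / rt <= `|imb true x| ->
  expect (fun s => imbalance_potential (32 / rt)
    (imb true (slush_round alpha (d s) (corrupt a x) s))) <=
  9 / 10 * imbalance_potential (32 / rt) (imb true x).
Proof.
move=> k2 n0 xd xn aF xo.
have n0' : 0 < n%:R :> R by rewrite ltr0n.
have rt0 : 0 < rt by rewrite sqrtr_gt0.
have rt2 : rt ^+ 2 = n%:R by rewrite sqr_sqrtr// ltW.
pose s0 : R := rt^-1.
have s0gt : 0 < s0 by rewrite invr_gt0.
have s02 : s0 ^+ 2 = n%:R^-1 by rewrite exprVn rt2.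
have rtn : rt / n%:R = s0 by rewrite -[X in _ / X]rt2 /s0; field; rewrite gt_eqF.
have [b bE] := majority_opinion n0 xd.
have yd := decided_corrupt a xd; set y := corrupt a x in yd *.
have phiE z : decided z -> imbalance_potential (32 / rt) (imb true z) =
    imbalance_potential (32 / rt) (imb b z).
  by move=> zd; rewrite /imbalance_potential (imbalance_normE b n0 zd).
rewrite phiE// -bE in xo *.
rewrite (imbalance_potential_outside (d := imb b x)); last by rewrite ger0_norm// bE.
rewrite (eq_expect (g := fun s => imbalance_potential (32 / rt)
    (imb b (slush_round alpha (d s) y s)))); last first.
  by move=> s; rewrite phiE// decided_round.
have -> : `|imb b x| = imb b x by rewrite ger0_norm// bE.
pose mu := expect (fun s => imb b (slush_round alpha (d s) y s)).
have Om : (0 < #|{: sampling n k}|)%N.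
  by rewrite card_ffun expn_gt0 card_tuple card_ord expn_gt0 n0.
have d1 : 32 * s0 <= 1 - imb b x.
  have := not_near_imbalance n0 b xn.
  rewrite mulrA -mulrA rtn; lra.
have dy : imb b x - 2 * s0 <= imb b y <= 1.
  have := imbalance_norm R n0 b y; rewrite ler_norml => /andP[_ ->]; rewrite andbT.
  have := imbalance_corrupt R n0 b a x; rewrite -/y ler_norml => /andP[h _].
  have : 2 * #|[set i | a i != None]|%:R / n%:R <= 2 * s0.
    by rewrite -rtn mulrA; apply: ler_wpM2r; [rewrite invr_ge0 ltW | lra].
  lra.
have mu1 : mu <= 1.
  rewrite -(expect_cst 1 Om); apply: le_expect => s.
  have := imbalance_norm R n0 b (slush_round alpha (d s) y s).
  by rewrite ler_norml => /andP[].
have xo' : 32 * s0 <= imb b x by exact: xo.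
have y0 : 0 < imb b y by have /andP[] := dy; lra.
have muge : imb b y * (3 - imb b y ^+ 2) / 2 <= mu <= 1.
  by rewrite mu1 andbT; apply: expect_imbalance_ge => //; exact: ltW.
have mu0 : 0 < mu.
  have /andP[h _] := muge; apply: lt_le_trans h.
  have /andP[_ h] := dy; nra.
pose v := expect (fun s => (imb b (slush_round alpha (d s) y s) - mu) ^+ 2).
have vle : 0 <= v <= 2 * (1 - mu) * s0 ^+ 2.
  rewrite s02 variance_imbalance// andbT -(expect_cst 0 Om).
  by apply: le_expect => s; exact: sqr_ge0.
have := majorant_contraction s0gt xo' d1 dy muge vle.
apply: le_trans.
(* The linear term of the majorant has mean zero. Its part free of the imbalance becomes the
   constant [1 / mu], so that only [mu] and [v] enter the expectation. *)
have -> : 32 * s0 * ((1 - mu) / mu + 2 * v / mu ^+ 3) + 4 * v / mu ^+ 2 =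
  expect (fun s => 32 * s0 * ((1 - mu) / mu + 1 / mu) +
     (- (32 * s0 / mu ^+ 2) * imb b (slush_round alpha (d s) y s) +
     (64 * s0 / mu ^+ 3 + 4 / mu ^+ 2) *
       (imb b (slush_round alpha (d s) y s) - mu) ^+ 2)).
  rewrite expectD (expect_cst (32 * s0 * _))// expectD !expectZ -/mu -/v.
  by field; rewrite gt_eqF.
apply: le_expect => s.
have k0 : 0 < 32 / rt by rewrite divr_gt0.
have mu01 : 0 < mu <= 1 by rewrite mu0.
have i1 := imbalance_norm R n0 b (slush_round alpha (d s) y s).
apply: le_trans (imbalance_potential_majorant k0 mu01 i1) _.
rewrite -/s0 le_eqVlt; apply/orP; left; apply/eqP.
by field; rewrite gt_eqF.
Qed.

(** The bound of [anticoncentration] for [ell = 64] and [eta = 4 ^- k]; it does not depend on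
    [n]. *)
Definition escape_prob : R := expR (- (9 * (4 * 65 * 4 ^+ k) ^+ 2)) / 4.

Lemma decided_drift_inside a x (d : sampling n k -> delivery n) :
  (2 <= k)%N -> (0 < n)%N -> decided x ->
  #|[set i | a i != None]|%:R <= rt ->
  (2 * (4 * 65 * 4 ^+ k)) ^+ 2 <= n%:R :> R ->
  128 / escape_prob <= rt ->
  `|imb true x| <= 32 / rt ->
  expect (fun s => imbalance_potential (32 / rt)
    (imb true (slush_round alpha (d s) (corrupt a x) s))) <=
  (1 - escape_prob / 4) * imbalance_potential (32 / rt) (imb true x).
Proof.
move=> k2 n0 xd aF nl1 nl2 xi.
have n0' : 0 < n%:R :> R by rewrite ltr0n.
have rt0 : 0 < rt by rewrite sqrtr_gt0.
have rt2 : rt ^+ 2 = n%:R by rewrite sqr_sqrtr// ltW.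
have q0 : 0 < escape_prob by rewrite divr_gt0 ?expR_gt0.
have q1 : escape_prob <= 4^-1.
  apply: ler_piMl; rewrite ?invr_ge0// expR_le1 oppr_le0.
  by apply: mulr_ge0 => //; exact: sqr_ge0.
set q := escape_prob in q0 q1 nl2 *.
(* Hence the potential before the round is at least [1 - q / 4], and a mean of at most [1 - q / 2]
   after it suffices. *)
have s1 : 32 / rt <= q / 4.
  rewrite ler_pdivrMr// mulrAC ler_pdivlMr//.
  by move: nl2; rewrite ler_pdivrMr//; lra.
have rtn : rt / n%:R = rt^-1 by rewrite -[X in _ / X]rt2; field; rewrite gt_eqF.
have yd := decided_corrupt a xd; set y := corrupt a x in yd *.
have yi : `|imb true y| <= 2^-1.
  have h1 := imbalance_corrupt R n0 true a x.
  have h2 := ler_distD 0 (imb true y) (imb true x).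
  have : 2 * #|[set i | a i != None]|%:R / n%:R <= 2 / rt.
    by rewrite -rtn mulrA; apply: ler_wpM2r; [rewrite invr_ge0 ltW | lra].
  have h3 : `|imb true y| <= `|imb true y - imb true x| + `|imb true x|.
    by rewrite -[X in `|X| <= _](subrK (imb true x)) ler_normD.
  have : 2 / rt = 32 / rt / 16 by field; rewrite gt_eqF.
  lra.
have [b bE] := majority_opinion n0 yd.
have b0 : 0 <= imb b y by rewrite bE.
have b2 : imb b y <= 2^-1 by rewrite bE.
have /andP[f0 f1] : 4^-1 <= share R b y <= 1 - 4^-1.
  by move: b0 b2; rewrite /imbalance => *; apply/andP; split; lra.
have eta_k : 0 < (4 ^- k : R) <= 2^-1.
  rewrite invr_gt0 exprn_gt0//= lef_pV2 ?posrE ?exprn_gt0//.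
  apply: (@le_trans _ _ (4 ^+ 1)); first by rewrite expr1; lra.
  by apply: ler_weXn2l; [lra | exact: ltnW].
have Om : (0 < #|{: sampling n k}|)%N.
  by rewrite card_ffun expn_gt0 card_tuple card_ord expn_gt0 n0.
have Ot : (0 < #|{: k.-tuple 'I_n}|)%N.
  by rewrite card_tuple card_ord expn_gt0 n0.
(* Each camp holds at least a quarter of the parties, so a unanimous sample for a given opinion has
   probability at least [4 ^- k], and it settles the vote. *)
have p_range i : 4 ^- k <= prob_agree R k b y i <= 1 - 4 ^- k.
  rewrite prob_agreeE//; set j := (X in binom_tail _ _ X).
  have /andP[j0 jk] : (0 < j <= k)%N.
    by have /andP[? ?] := majority_threshold k2; rewrite /j; case: ifP.
  have f01 := share_range R n0 b y.
  apply/andP; split.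
    apply: le_trans (binom_tail_ge f01 jk); rewrite -exprVn.
    by apply: lerXn2r => //; rewrite nnegrE; lra.
  apply: le_trans (binom_tail_le k f01 j0) _; rewrite lerD2l lerN2 -exprVn.
  by apply: lerXn2r => //; rewrite ?nnegrE; lra.
have mean0 : 0 <= \sum_i (2 * prob_agree R k b y i - 1).
  have : 0 <= expect (fun s => imb b (slush_round alpha (d s) y s)).
    apply: le_trans (expect_imbalance_ge n0 d k2 yd b0).
    by apply: divr_ge0 => //; apply: mulr_ge0 => //; nra.
  by rewrite expect_imbalance// pmulr_lge0 ?invr_gt0.
have lamE : 4 * 65 * 4 ^+ k = 4 * (64 + 1) / 4 ^- k :> R by rewrite invrK; ring.
have nl : (2 * (4 * 65 * 4 ^+ k)) ^+ 2 <= #|'I_n|%:R :> R by rewrite card_ord.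
have := anticoncentration Ot eta_k _ p_range mean0 lamE nl.
rewrite card_ord -/(escape_prob) => /(_ (ler0n _ 64)) esc.
apply: (@le_trans _ _ (1 - q / 2)); last first.
  have -> : imbalance_potential (32 / rt) (imb true x) = 1 - `|imb true x|.
    rewrite /imbalance_potential max_r// mulrAC divff ?mul1r//.
    by rewrite gt_eqF// divr_gt0.
  nra.
(* On the escape event the imbalance reaches [64 / rt], twice the cap, where the potential is at
   most 1/2; elsewhere it is at most 1. *)
apply: (@le_trans _ _ (expect (fun s : sampling n k => 1 + - 2^-1 *
   ((64 * rt <= \sum_i (2 * (updated y (y i) (s i) == Some b)%:R - 1))%R%:R)))).
  apply: le_expect => s.
  have k0 : 0 < 32 / rt by rewrite divr_gt0.
  have -> : imbalance_potential (32 / rt) (imb true (slush_round alpha (d s) y s)) =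
      imbalance_potential (32 / rt) (imb b (slush_round alpha (d s) y s)).
    by rewrite /imbalance_potential (imbalance_normE b n0)// decided_round.
  have i1 := imbalance_norm R n0 b (slush_round alpha (d s) y s).
  set S := \sum_i _; case: (lerP (64 * rt) S) => h /=; last first.
    rewrite mulr0 addr0; apply: le_trans (imbalance_potential_le k0 i1) _.
    by rewrite gerBl.
  rewrite mulr1 (_ : 1 + - 2^-1 = 2^-1 :> R); last by field.
  apply: imbalance_potential_le_half => //; rewrite i1 andbT.
  apply: le_trans (ler_norm _).
  rewrite imbalance_sum//.
  rewrite [X in _ <= X / _](_ : _ = S); last first.
    by apply: eq_bigr => i _; rewrite slush_round_decided.
  rewrite ler_pdivlMr//; apply: le_trans h.
  rewrite -[X in _ * X <= _]rt2 le_eqVlt; apply/orP; left; apply/eqP.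
  by field; rewrite gt_eqF.
rewrite expectD expectZ (expect_cst 1)// lerD2l mulNr lerN2 mulrC.
by apply: ler_wpM2l; [rewrite invr_ge0 | exact: esc].
Qed.
End DecidedDrift.

(** * Spreading of opinions to parties that have none *)

Section Spreading.
Variables (R : realType) (n k : nat).
Implicit Types (x y : opinions n) (a : corruption n) (s : sampling n k).

Definition informed x : nat := #|[pred i | x i != None]|.

Definition ignorance_ratio x : R := (n%:R - (informed x)%:R) / (informed x)%:R.

(** The delivery order decides which opinion is adopted, never whether one is. *)
Lemma slush_round_informed alpha d y s j :
  (slush_round alpha d y s j != None) =
  (y j != None) || [exists i, asks y s i j].
Proof.
rewrite ffunE /reply; case yj: (y j) => [b|] /=.
  by do 2!case: ifP => // _.
apply/idP/existsP => [|[i yi]]; rewrite /first_asker.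
  case e: [seq _ <- _ | _] => [|i l] //= _; exists i.
  have : i \in [seq i <- codom (d j) | asks y s i j] by rewrite e mem_head.
  by rewrite mem_filter => /andP[].
case e: [seq _ <- _ | _] => [|i' l] /=.
  have : i \in [seq i <- codom (d j) | asks y s i j].
    by rewrite mem_filter yi -(permKV (d j) i) codom_f.
  by rewrite e.
have : i' \in [seq i <- codom (d j) | asks y s i j] by rewrite e mem_head.
by rewrite mem_filter => /andP[/andP[]].
Qed.

Lemma leq_informed_corrupt a x : (informed x <= informed (corrupt a x))%N.
Proof.
by apply/subset_leq_card/subsetP => j; rewrite !inE ffunE; case: (a j).
Qed.

Lemma informed_le x : (informed x <= n)%N.
Proof. by rewrite (leq_trans (max_card _)) ?card_ord. Qed.

Lemma informed_gt0 x : (exists i, x i <> None) -> (0 < informed x)%N.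
Proof. by case=> i /eqP xi; apply/card_gt0P; exists i. Qed.

Lemma decidedE x : decided x = (informed x == n).
Proof.
rewrite /informed -[X in _ == X]card_ord; apply/forallP/eqP => [h|h i].
  by apply: eq_card => i; rewrite !inE h.
by have := subset_cardP h (subset_predT _) i; rewrite !inE.
Qed.

Definition newly y s : nat :=
  #|[pred j | (y j == None) && [exists i, asks y s i j]]|.

Lemma informed_round alpha d y s :
  informed (slush_round alpha d y s) = (informed y + newly y s)%N.
Proof.
rewrite /informed /newly -cardUI [X in (_ + X)%N]eq_card0 ?addn0 => [|j]; last first.
  by rewrite !inE; case: (y j).
apply: eq_card => j; rewrite !inE slush_round_informed.
by case: (y j).
Qed.

Lemma newly_le y s : (newly y s <= k * informed y)%N.
Proof.
rewrite /newly -sum1_card.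
apply: (@leq_trans (\sum_(j : 'I_n) \sum_(i : 'I_n) asks y s i j)).
  rewrite big_mkcond; apply: leq_sum => j _; rewrite inE.
  case: ifP => // /andP[_ /existsP[i h]].
  by rewrite (bigD1 i)//= h.
rewrite exchange_big /informed -sum1_card big_distrr big_mkcond /=.
rewrite [X in (_ <= X)%N]big_mkcond; apply: leq_sum => i _.
rewrite /asks inE; case: (y i) => [c|] /=; last by rewrite big1.
rewrite muln1 -big_mkcond sum1_card.
by apply: leq_trans (card_size _) _; rewrite size_tuple.
Qed.

Hypothesis n_gt0 : (0 < n)%N.
Hypothesis k_gt0 : (0 < k)%N.

Let card_samples : (0 < #|{: k.-tuple 'I_n}|)%N.
Proof. by rewrite card_tuple card_ord expn_gt0 n_gt0. Qed.

(** Already the first of the [k] draws misses [j] with probability only [1 - 1/n]. *)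
Lemma expect_not_sampled (j : 'I_n) :
  expect (fun t : k.-tuple 'I_n => (j \notin t)%:R) <= 1 - n%:R^-1 :> R.
Proof.
have e (t : k.-tuple 'I_n) :
    ((j \notin t)%:R : R) = -1 * (0 < count (pred1 j) t)%N%:R + 1.
  by rewrite -has_count has_pred1; case: (j \in t) => /=; ring.
rewrite (eq_expect e) expectD expectZ (expect_cst 1)// (expect_count R _ _ _ n_gt0).
rewrite card1 mulN1r addrC lerD2l lerN2 div1r.
case: k k_gt0 => // k' _ /=; rewrite binom_tail0 mulr1 lerDl.
have i1 : 0 <= (n%:R^-1 : R) <= 1.
  by rewrite invr_ge0 ler0n /= invf_le1 ?ler1n ?ltr0n.
rewrite mulr_ge0 ?subr_ge0//; first by case/andP: i1.
by have /andP[] := binom_tail_range k' 1 i1.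
Qed.

(** As [m / n <= 1], the probability of at least one hit is at least half of its union bound
    [m / n]. *)
Lemma pow_inv_le m : (m <= n)%N ->
  (1 - n%:R^-1) ^+ m <= 1 - m%:R / (2 * n%:R) :> R.
Proof.
elim: m => [|m IHm] mn; first by rewrite expr0 mul0r subr0.
have n0 : 0 < n%:R :> R by rewrite ltr0n.
have {}IHm := IHm (ltnW mn); rewrite exprS -natr1.
move: IHm; rewrite !invfM.
set u : R := n%:R^-1; have u0 : 0 < u by rewrite invr_gt0.
have u1 : u <= 1 by rewrite invf_le1 ?ler1n.
have mu : m%:R * u <= 1 by rewrite ler_pdivrMr// mul1r ler_nat ltnW.
have u1' : 0 <= 1 - u by rewrite subr_ge0.
move=> /(ler_wpM2l u1'); have := ler_wpM2r (ltW u0) mu; nra.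
Qed.

(** The informed parties sample independently, so the probability that all of them miss [j] is
    bounded by a product. *)
Lemma expect_asked y (j : 'I_n) :
  (informed y)%:R / (2 * n%:R) <=
  expect (fun s => [exists i, asks y s i j]%:R) :> R.
Proof.
have e s : ([exists i, asks y s i j]%:R : R) =
    1 + -1 * \prod_i (~~ asks y s i j)%:R.
  case: existsP => [[i h]|h].
    by rewrite (bigD1 i)//= h mul0r mulr0 addr0.
  rewrite big1 ?mulr1 ?subrr// => i _; case: (boolP (asks _ _ _ _)) => // hi.
  by case: h; exists i.
rewrite (eq_expect e) expectD expectZ (expect_cst 1); last first.
  by rewrite card_ffun expn_gt0 card_samples.
rewrite (expect_prod (fun i (t : k.-tuple 'I_n) =>
  (~~ ((y i != None) && (j \in t)))%:R)) mulN1r lerBrDl -lerBrDr.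
apply: le_trans (pow_inv_le (informed_le y)).
rewrite /informed -prodr_const [X in _ <= X]big_mkcond.
apply: ler_prod => i _; rewrite -(expect_cst 0 card_samples) le_expect//=.
rewrite inE; case: (y i) => [c|] /=; first exact: expect_not_sampled.
by rewrite (expect_cst 1 card_samples).
Qed.

Lemma expect_newly y :
  (n%:R - (informed y)%:R) * (informed y)%:R / (2 * n%:R) <=
  expect (fun s => (newly y s)%:R) :> R.
Proof.
have e s : ((newly y s)%:R : R) =
    \sum_j (y j == None)%:R * [exists i, asks y s i j]%:R.
  rewrite /newly -sum1_card natr_sum big_mkcond; apply: eq_bigr => j _.
  by rewrite inE -natrM mulnb; case: (_ && _).
rewrite (eq_expect e) expect_sum.
have -> : n%:R - (informed y)%:R = \sum_j (y j == None)%:R :> R.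
  apply/eqP; rewrite subr_eq -natr_sum -natrD eqr_nat; apply/eqP.
  rewrite -[LHS]card_ord -(cardC [pred j | y j != None]) addnC; congr addn.
  rewrite -sum1_card big_mkcond; apply: eq_bigr => j _.
  by rewrite !inE negbK; case: (_ == _).
rewrite -mulrA mulr_suml; apply: ler_sum => j _; rewrite expectZ.
by apply: ler_wpM2l => //; exact: expect_asked.
Qed.

(** The adversary can only add informed parties, which lowers the ratio. The next ratio lies below
    an affine function of [newly], so the mean of [newly] suffices. *)
Lemma ignorance_drift alpha a x (d : sampling n k -> delivery n) :
  (exists i, x i <> None) ->
  expect (fun s => ignorance_ratio (slush_round alpha (d s) (corrupt a x) s)) <=
  (1 - (2 * k.+1%:R)^-1) * ignorance_ratio x.
Proof.
move=> /informed_gt0 mx0; set y := corrupt a x.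
have n0 : 0 < n%:R :> R by rewrite ltr0n.
have k0 : 0 < k.+1%:R :> R by rewrite ltr0n.
have kk : k%:R + 1 = k.+1%:R :> R by rewrite natr1.
have mxy : (informed x <= informed y)%N by exact: leq_informed_corrupt.
have my0 : (0 < informed y)%N by apply: leq_trans mxy.
have ratio_le : ignorance_ratio y <= ignorance_ratio x.
  rewrite /ignorance_ratio ler_pM ?invr_ge0 ?subr_ge0 ?ler_nat ?informed_le//.
    by rewrite lerD2l lerN2 ler_nat.
  by rewrite lef_pV2 ?posrE ?ltr0n// ler_nat.
have ck : 0 <= 1 - (2 * k.+1%:R)^-1 :> R.
  by rewrite subr_ge0 invf_le1 ?mulr_gt0// -natrM ler1n.
apply: le_trans (ler_wpM2l ck ratio_le).
have kN : 1 + k%:R != 0 :> R by rewrite addrC kk gt_eqF.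
set K : R := k.+1%:R in k0 kk ck *.
have := expect_newly y; rewrite /ignorance_ratio.
set m : R := (informed y)%:R; set EN := expect _ => hN.
have m0 : 0 < m by rewrite ltr0n.
have mn : m <= n%:R by rewrite ler_nat informed_le.
pose c : R := n%:R / (K * m ^+ 2).
apply: (@le_trans _ _ (expect (fun s => (n%:R - m) / m + - c * (newly y s)%:R))).
  apply: le_expect => s; rewrite informed_round natrD -/m.
  set N : R := (newly y s)%:R.
  have N0 : 0 <= N by rewrite ler0n.
  have Nle : N <= k%:R * m by rewrite -natrM ler_nat newly_le.
  have mN : 0 < m + N by rewrite ltr_wpDr.
  rewrite -subr_ge0.
  have -> : (n%:R - m) / m + - c * N - (n%:R - (m + N)) / (m + N) =
      n%:R * N * (K * m - (m + N)) / (K * m ^+ 2 * (m + N)).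
    by rewrite /c; field; rewrite kN (gt_eqF m0) (gt_eqF mN).
  apply: divr_ge0.
    by apply: mulr_ge0; [rewrite mulr_ge0 ?ler0n | rewrite -kk; lra].
  by rewrite !mulr_ge0 ?exprn_ge0 ?ltW.
rewrite expectD (expectZ (- c)) -/EN (expect_cst ((n%:R - m) / m)); last first.
  by rewrite card_ffun expn_gt0 card_samples.
have c0 : 0 <= c by rewrite divr_ge0 ?mulr_ge0 ?exprn_ge0 ?ltW.
have := ler_wpM2l c0 hN.
have -> : c * ((n%:R - m) * m / (2 * n%:R)) =
    (2 * K)^-1 * ((n%:R - m) / m).
  by rewrite /c; field; rewrite kN (gt_eqF m0) (gt_eqF n0).
by move=> h; rewrite [X in _ <= X]mulrBl mul1r mulNr lerD2l lerN2.
Qed.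
End Spreading.

(** * The combined potential and the failure probability *)

Section SlushPotential.
Variables (R : realType) (n k : nat).
Implicit Types (x y : opinions n) (a : corruption n).
Local Notation alpha := (uphalf k.+1).
Local Notation rt := (Num.sqrt n%:R : R).

(** With some but not all parties informed, the weight lifts the value to at least [4 * k.+1],
    whereas decided states have value at most 1; this leaves room for the change of phase. *)
Definition potential x : R :=
  if decided x then imbalance_potential (32 / rt) (imbalance R true x)
  else 4 * k.+1%:R * n%:R * ignorance_ratio R x.

(** The rates for large imbalance, small imbalance and spreading. The last keeps only half of the
    gain in [ignorance_drift]. *)
Definition contraction_rate : R :=
  Num.max (9 / 10) (Num.max (1 - escape_prob R k / 4) (1 - (4 * k.+1%:R)^-1)).

Lemma escape_prob_gt0 : 0 < escape_prob R k.
Proof. by rewrite divr_gt0 ?expR_gt0. Qed.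

Lemma contraction_rate_range : 0 < contraction_rate < 1.
Proof.
rewrite lt_max divr_gt0//= !gt_max !gtrBl invr_gt0 divr_gt0 ?escape_prob_gt0//.
by rewrite mulr_gt0// andbT ltr_pdivrMr//; lra.
Qed.

Hypothesis k2 : (2 <= k)%N.
Hypothesis n_gt0 : (0 < n)%N.
Hypothesis n1 : (2 * (4 * 65 * 4 ^+ k)) ^+ 2 <= n%:R :> R.
Hypothesis n2 : 128 / escape_prob R k <= rt.
Hypothesis n3 : 32 <= rt.

Let n0 : 0 < n%:R :> R. Proof. by rewrite ltr0n. Qed.
Let rt0 : 0 < rt. Proof. by rewrite sqrtr_gt0. Qed.
Let rt2 : rt ^+ 2 = n%:R. Proof. by rewrite sqr_sqrtr// ltW. Qed.
Let kap0 : 0 < 32 / rt. Proof. by rewrite divr_gt0. Qed.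
Let kap1 : 32 / rt <= 1. Proof. by rewrite ler_pdivrMr// mul1r. Qed.

Lemma ignorance_ge0 x : 0 <= ignorance_ratio R x.
Proof. by rewrite divr_ge0 ?subr_ge0 ?ler_nat ?informed_le. Qed.

Lemma ignorance_le x : (exists i, x i <> None) -> ignorance_ratio R x <= n%:R.
Proof.
move=> /informed_gt0 m0; rewrite ler_pdivrMr ?ltr0n//.
have : 1 <= (informed x)%:R :> R by rewrite ler1n.
by have := n0; nra.
Qed.

Lemma ignorance_ge x : (exists i, x i <> None) -> ~~ decided x ->
  n%:R^-1 <= ignorance_ratio R x.
Proof.
move=> /informed_gt0 m0; rewrite decidedE => mn.
have lt_mn : (informed x < n)%N by rewrite ltn_neqAle mn informed_le.
rewrite ler_pdivlMr ?ltr0n// mulrC ler_pdivrMr//.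
have h : 1 <= n%:R - (informed x)%:R :> R by rewrite lerBrDr nat1r ler_nat.
apply: (@le_trans _ _ (1 * n%:R)); first by rewrite mul1r ler_nat ltnW.
by rewrite ler_pM2r.
Qed.

Lemma potential_le x : (exists i, x i <> None) ->
  potential x <= 4 * k.+1%:R * n%:R ^+ 2.
Proof.
move=> xi; rewrite /potential; case: ifP => _.
  apply: le_trans (imbalance_potential_le kap0 (imbalance_norm R n_gt0 true x)) _.
  apply: (@le_trans _ _ 1); first by rewrite gerBl.
  by rewrite -natrX -!natrM ler1n !muln_gt0 /= n_gt0.
rewrite expr2 mulrA ler_wpM2l ?ignorance_le//.
by rewrite !mulr_ge0.
Qed.

Lemma potential_ge0 x : 0 <= potential x.
Proof.
rewrite /potential; case: ifP => _; last first.
  by apply: mulr_ge0 (ignorance_ge0 x); rewrite !mulr_ge0.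
have h := imbalance_norm R n_gt0 true x.
have k01 : 0 < 32 / rt <= 1 by rewrite kap0.
apply: le_trans (imbalance_potential_ge k01 h).
by rewrite mulr_ge0 ?subr_ge0// ltW.
Qed.

Lemma potential_ge x : (exists i, x i <> None) ->
  ~~ near_consensus (16 * rt) x -> n%:R^-1 <= potential x.
Proof.
move=> xi xn; rewrite /potential; case: (boolP (decided x)) => xd; last first.
  apply: le_trans (ignorance_ge xi xd) _.
  rewrite ler_peMl ?ignorance_ge0// -!natrM ler1n !muln_gt0 //=.
have h := imbalance_norm R n_gt0 true x.
have k01 : 0 < 32 / rt <= 1 by rewrite kap0.
apply: le_trans (imbalance_potential_ge k01 h).
have [b <-] := majority_opinion R n_gt0 xd.
have := not_near_imbalance n_gt0 b xn.
have -> : 2 * (16 * rt) / n%:R = 32 / rt.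
  by rewrite -[X in _ * _ / X]rt2; field; rewrite gt_eqF.
move=> hb.
(* Away from consensus [1 - |d|] exceeds [32 / rt], so the potential is at least the square
   [1024 / n]. *)
apply: (@le_trans _ _ (32 / rt * (32 / rt))).
  have -> : 32 / rt * (32 / rt) = 1024 / n%:R.
    by rewrite -[X in _ = _ / X]rt2; field; rewrite gt_eqF.
  by apply: ler_peMl; rewrite ?invr_ge0 ?ler1n.
by rewrite ler_pM2l//; lra.
Qed.

Lemma potential_drift a x (d : sampling n k -> delivery n) :
  (exists i, x i <> None) -> ~~ near_consensus (16 * rt) x ->
  #|[set i | a i != None]|%:R <= rt ->
  expect (fun s => potential (slush_round alpha (d s) (corrupt a x) s)) <=
  contraction_rate * potential x.
Proof.
move=> xi xn aF; have P0 := potential_ge0 x.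
have [r1 r2 r3] : [/\ 9 / 10 <= contraction_rate,
    1 - escape_prob R k / 4 <= contraction_rate &
    1 - (4 * k.+1%:R)^-1 <= contraction_rate].
  by rewrite /contraction_rate !le_max !lexx !orbT.
move: P0; rewrite {1 3}/potential; case: (boolP (decided x)) => xd P0.
  rewrite (eq_expect (g := fun s => imbalance_potential (32 / rt)
      (imbalance R true (slush_round alpha (d s) (corrupt a x) s)))); last first.
    by move=> s; rewrite /potential decided_round// decided_corrupt.
  have [h|h] := lerP (32 / rt) `|imbalance R true x|.
    apply: le_trans (decided_drift_outside d k2 n_gt0 xd xn aF h) _.
    by apply: ler_wpM2r.
  apply: le_trans (decided_drift_inside d k2 n_gt0 xd aF n1 n2 (ltW h)) _.
  by apply: ler_wpM2r.
apply: le_trans _ (ler_wpM2r P0 r3).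
set D : R := 4 * k.+1%:R * n%:R.
have D0 : 0 <= D by rewrite !mulr_ge0.
have Om : (0 < #|{: sampling n k}|)%N.
  by rewrite card_ffun expn_gt0 card_tuple card_ord expn_gt0 n_gt0.
(* The summand 1 covers the rounds after which every party has an opinion. Half of the spreading
   gain, [n * r >= 1], pays for it. *)
apply: (@le_trans _ _ (expect (fun s =>
   D * ignorance_ratio R (slush_round alpha (d s) (corrupt a x) s) + 1))).
  apply: le_expect => s; rewrite /potential; case: ifP => _; last by rewrite lerDl.
  apply: ler_wpDl; first by rewrite mulr_ge0 ?ignorance_ge0.
  apply: le_trans (imbalance_potential_le kap0 (imbalance_norm R n_gt0 true _)) _.
  by rewrite gerBl.
rewrite expectD expectZ (expect_cst 1)//.
have h := ignorance_drift R n_gt0 (ltnW k2) alpha a d xi.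
apply: le_trans (lerD (ler_wpM2l D0 h) (lexx 1)) _.
have K0 : 0 < k.+1%:R :> R by rewrite ltr0n.
have := ignorance_ge xi xd; set r := ignorance_ratio R x => hr.
have : 1 <= n%:R * r by rewrite mulrC -ler_pdivrMr// div1r.
have -> : (1 - (4 * k.+1%:R)^-1) * (D * r) = D * r - n%:R * r.
  by rewrite /D; field; rewrite addrC natr1 gt_eqF.
have -> : D * ((1 - (2 * k.+1%:R)^-1) * r) = D * r - 2 * (n%:R * r).
  by rewrite /D; field; rewrite addrC natr1 gt_eqF.
lra.
Qed.

Lemma slush_miss_prob (adv : adversary n k) (sch : scheduler n k) x0 T :
  (exists i, x0 i <> None) -> adversary_bounded rt adv ->
  1 - unif_prob R (reaches_within alpha adv sch x0 (16 * rt) T) <=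
  4 * k.+1%:R * n%:R ^+ 3 * contraction_rate ^+ T.
Proof.
move=> x0i advF.
have Om : (0 < #|{: sampling n k}|)%N.
  by rewrite card_ffun expn_gt0 card_tuple card_ord expn_gt0 n_gt0.
have OT : (0 < #|{: T.-tuple (sampling n k)}|)%N by rewrite card_tuple expn_gt0 Om.
(* The state carries the log, on which adversary and scheduler depend, so the drift bound holds
   conditionally on the whole past. *)
pose C := (seq (round_log n k) * opinions n)%type.
pose target (c : C) := near_consensus (16 * rt) c.2.
have /andP[rho0 _] := contraction_rate_range.
have step_inv (c : C) s : (exists i, c.2 i <> None) ->
    exists i, (slush_step alpha adv sch c s).2 i <> None.
  case: c => l x [i /eqP xi]; exists i; apply/eqP.
  by rewrite /= slush_round_informed ffunE; case: (adv l x i) => //=;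
    rewrite [x i != _]xi.
have := expect_avoids (target := target) (V := fun c : C => potential c.2)
  (vmin := n%:R^-1)
  (inv := fun c : C => exists i, c.2 i <> None) step_inv (ltW rho0)
  (fun c _ => potential_ge0 c.2)
  (fun c => @potential_ge c.2).
have drift (c : C) : (exists i, c.2 i <> None) -> ~~ target c ->
    expect (fun s => potential (slush_step alpha adv sch c s).2) <=
    contraction_rate * potential c.2.
  case: c => l x /= xi xn.
  exact: (potential_drift (fun s => sch l (corrupt (adv l x) x) s) xi xn (advF l x)).
move=> /(_ drift T ([::], x0) x0i) /=.
set E := expect _ => hE.
have hlow : 1 - unif_prob R (reaches_within alpha adv sch x0 (16 * rt) T) <= E.
  set W := reaches_within _ _ _ _ _ _.
  have -> : 1 - unif_prob R W = expect (fun w => 1 - (w \in W)%:R).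
    by rewrite expectD expectN (expect_cst 1 OT) expect_indicator.
  apply: le_expect => w; rewrite avoidsE inE.
  case: existsP => [_|hx] /=; first by rewrite subrr.
  rewrite subr0; suff -> : [forall t : 'I_(size w).+1,
    ~~ target (foldl (slush_step alpha adv sch) ([::], x0) (take t w))] by [].
  apply/forallP => -[t ht] /=; apply/negP => hn; apply: hx.
  by move: ht; rewrite size_tuple => ht; exists (Ordinal ht).
apply: (le_trans hlow); rewrite ler_pdivrMl// in hE.
apply: (le_trans hE).
rewrite exprS.
have -> : 4 * k.+1%:R * (n%:R * n%:R ^+ 2) * contraction_rate ^+ T =
  n%:R * (contraction_rate ^+ T * (4 * k.+1%:R * n%:R ^+ 2)) by ring.
rewrite ler_pM2l//; apply: ler_wpM2l; first by rewrite exprn_ge0 ?ltW.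
exact: potential_le.
Qed.

End SlushPotential.

(** * Choice of the constants and of the threshold for [n] *)

Theorem theorem4p8 (R : realType) (k : nat) (hk : (2 <= k)%N) :
  exists A B c : R, [/\ 0 < A, 0 < B, 1 <= c &
    exists N : nat, forall n : nat, (N <= n)%N ->
    forall x0 : opinions n, (exists i : 'I_n, x0 i <> None) ->
    forall adv : adversary n k, adversary_bounded (Num.sqrt n%:R : R) adv ->
    forall sch : scheduler n k,
      1 - n%:R `^ (- c) <=
      unif_prob R (reaches_within (uphalf k.+1) adv sch x0
                     (B * Num.sqrt n%:R) (Num.truncn (A * ln n%:R)))].
Proof.
have := contraction_rate_range R k; set rho := contraction_rate R k.
move=> /andP[rho0 rho1].
pose q := escape_prob R k; have q0 : 0 < q := escape_prob_gt0 R k.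
(* This [A] makes [rho ^+ T] of order [n^-5]: three powers cancel the [n^3] of [slush_miss_prob],
   one is the claimed rate, one absorbs the constant. *)
exists (5 / (1 - rho)), 16, 1; split => //.
  by rewrite divr_gt0 ?subr_gt0.
(* The summands of [M] serve, in turn, the size condition of [anticoncentration], the bound on
   [128 / q], the final constant, and [32 <= sqrt n]. *)
pose b1 : R := (2 * (4 * 65 * 4 ^+ k)) ^+ 2.
pose b2 : R := (128 / q) ^+ 2.
pose b3 : R := 4 * k.+1%:R * expR 1.
pose M : R := b1 + b2 + b3 + 1024.
have b1_ge0 : 0 <= b1 by exact: sqr_ge0.
have b2_ge0 : 0 <= b2 by exact: sqr_ge0.
have b3_ge0 : 0 <= b3 by rewrite !mulr_ge0 ?expR_ge0.
exists (Num.truncn M).+1 => n nM x0 x0i adv advF sch.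
have Mn : M <= n%:R.
  apply: ltW; apply: (lt_le_trans (truncnS_gt M)); by rewrite ler_nat.
have n_gt0 : (0 < n)%N by apply: leq_trans nM.
have n0 : 0 < n%:R :> R by rewrite ltr0n.
have sqrt_ge (u : R) : 0 <= u -> u ^+ 2 <= M -> u <= Num.sqrt n%:R.
  move=> u0 uM; rewrite -(ger0_norm u0) -sqrtr_sqr.
  by apply: ler_wsqrtr; exact: le_trans uM Mn.
have n1 : (2 * (4 * 65 * 4 ^+ k)) ^+ 2 <= n%:R :> R.
  by rewrite -/b1; rewrite /M in Mn; lra.
have n2 : 128 / escape_prob R k <= Num.sqrt n%:R.
  by apply: sqrt_ge; [rewrite divr_ge0 ?ltW|rewrite -/b2 /M; lra].
have n3 : 32 <= Num.sqrt n%:R :> R by apply: sqrt_ge => //; rewrite /M; lra.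
have := truncnS_gt (5 / (1 - rho) * ln n%:R).
move: (Num.truncn _) => T T_gt.
have := slush_miss_prob hk n_gt0 n1 n2 n3 sch T x0i advF.
rewrite -/rho => hA.
rewrite lerBlDr -lerBlDl; apply: (le_trans hA).
rewrite powR_inv1 ?ler0n//.
(* Truncating the number of rounds loses less than one round, which costs at most the factor
   [expR 1]. *)
have rhoT : rho ^+ T <= expR 1 / n%:R ^+ 5.
  apply: (@le_trans _ _ (expR (- (1 - rho)) ^+ T)).
    apply: lerXn2r; rewrite ?nnegrE ?expR_ge0 ?(ltW rho0)//.
    by apply: le_trans (expR_ge1Dx _); lra.
  rewrite -expRM_natl -[X in _ / X ^+ _](lnK (x := n%:R)) ?posrE//.
  rewrite -expRM_natl -expRB.
  rewrite ler_expR.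
  move: T_gt; rewrite mulrAC ltr_pdivrMr ?subr_gt0// -natr1; nra.
apply: (@le_trans _ _ (4 * k.+1%:R * n%:R ^+ 3 * (expR 1 / n%:R ^+ 5))).
  by rewrite ler_wpM2l// !mulr_ge0 ?exprn_ge0.
have -> : 4 * k.+1%:R * n%:R ^+ 3 * (expR 1 / n%:R ^+ 5) = b3 / n%:R / n%:R.
  by rewrite /b3; field; rewrite gt_eqF.
apply: ler_piMl; first by rewrite invr_ge0 ltW.
by rewrite ler_pdivrMr// mul1r; rewrite /M in Mn; lra.
Qed.
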